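(* Let $N\ge2$ and let $u,v:\mathbb{R}^N\to\mathbb{R}$ be two continuous, positive radial functions such that $$u(x)\sim|x|^ae^{-b|x|+c|x|^\gamma},\qquad v(x)\sim|x|^{a'}e^{-b|x|+c'|x|^{\gamma}}\qquad\text{as }|x|\to\infty,$$ where $b>0$, $\gamma\in(0,1)$, $c,c'>0$ and $a,a'\in\mathbb{R}$. Then $$\int_{\mathbb{R}^N}u_\xi v\ \sim\ |\xi|^{\frac{N+1}2+a+a'-\frac\gamma2}e^{-b|\xi|+\tilde c|\xi|^\gamma}\quad\text{as }|\xi|\to\infty,\qquad\text{with }\ \tilde c=\left((c')^{\frac1{1-\gamma}}+c^{\frac1{1-\gamma}}\right)^{1-\gamma}.$$
   Context: For $\xi\in\mathbb{R}^N$, $u_\xi(x)=u(x-\xi)$. For positive functions, $f\sim g$ as $|x|\to\infty$ means that there are constants $C_1,C_2>0$ with $C_1g(x)\le f(x)\le C_2g(x)$ for all $|x|$ large enough. *)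

(* Defs.v *)
From HB Require Import structures.
From mathcomp Require Import all_boot all_order all_algebra.
From mathcomp Require Import all_classical all_reals all_analysis.
Set Implicit Arguments.
Unset Strict Implicit.
Unset Printing Implicit Defensive.
Import Order.TTheory GRing.Theory Num.Theory.
Import numFieldNormedType.Exports.
Local Open Scope classical_set_scope.
Local Open Scope ring_scope.

(* The library norm on matrices is the sup norm, so |x| is defined here. *)
Definition enorm (R : realType) (n : nat) (x : 'rV[R]_n) : R :=
  Num.sqrt (\sum_(i < n) x ord0 i ^+ 2).

Definition radial (R : realType) (n : nat) (f : 'rV[R]_n -> R) : Prop :=
  forall x y, enorm x = enorm y -> f x = f y.

Definition translate (R : realType) (n : nat) (xi : 'rV[R]_n)
    (f : 'rV[R]_n -> R) : 'rV[R]_n -> R :=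
  fun x => f (x - xi).

(* When f is an Rintegral and g > 0 far out, the lower bound excludes the value
   0 that Rintegral takes on a divergent integral, so the relation includes the
   finiteness of the integral for |x| >= r. *)
Definition sim_infty (R : realType) (n : nat) (f g : 'rV[R]_n -> R) : Prop :=
  exists C1 C2 r : R, [/\ 0 < C1, 0 < C2 &
    forall x, r <= enorm x -> C1 * g x <= f x <= C2 * g x].

(* The product sigma-algebra, generated by the coordinates as for n.-tuple in
   the library; for R^n it is the Borel one. *)
Fact measure_rV_display : measure_display. Proof. by constructor. Qed.

Section measurable_rV.
Context {R : realType} (n : nat).

Let coor (i : 'I_n) (x : 'rV[R]_n) : measurableTypeR R := x ord0 i.

Let rV_set0 : g_sigma_preimage coor set0.
Proof. exact: sigma_algebra0. Qed.

Let rV_setC A : g_sigma_preimage coor A -> g_sigma_preimage coor (~` A).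
Proof. exact: sigma_algebraC. Qed.

Let rV_bigcup (F : _^nat) : (forall i, g_sigma_preimage coor (F i)) ->
  g_sigma_preimage coor (\bigcup_i (F i)).
Proof. exact: sigma_algebra_bigcup. Qed.

HB.instance Definition _ := @isMeasurable.Build measure_rV_display
  'rV[R]_n (g_sigma_preimage coor) rV_set0 rV_setC rV_bigcup.

Lemma measurable_coor (i : 'I_n) :
  measurable_fun [set: 'rV[R]_n] (fun x => x ord0 i : measurableTypeR R).
Proof.
move=> _ Y mY; rewrite setTI; apply: sub_sigma_algebra => /=.
rewrite -bigcup_seq/=; exists i => /=; first by rewrite mem_index_enum.
by exists Y => //; rewrite setTI.
Qed.

Lemma measurable_fun_rV d (T : measurableType d) (f : T -> 'rV[R]_n) :
  (forall i, measurable_fun [set: T] (fun t => f t ord0 i : measurableTypeR R)) ->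
  measurable_fun [set: T] f.
Proof.
move=> mf _ Y mY; rewrite setTI.
pose C : set (set 'rV[R]_n) := fun A => d.-measurable (f @^-1` A).
suff : g_sigma_preimage coor `<=` C by exact.
apply: smallest_sub.
  split; rewrite /C/=; first by rewrite preimage_set0.
  - by move=> A mA; rewrite setTD preimage_setC; exact: measurableC.
  - by move=> F mF; rewrite preimage_bigcup; exact: bigcupT_measurable.
rewrite -bigcup_seq => A [i _ [B mB <-]]; rewrite /C setTI.
by have := mf i measurableT B mB; rewrite setTI.
Qed.

End measurable_rV.

Definition row_cons {R : realType} (n : nat)
    (p : measurableTypeR R * 'rV[R]_n) : 'rV[R]_n.+1 :=
  row_mx (const_mx p.1 : 'rV[R]_1) p.2.

Definition row_behead {R : realType} (n : nat) (x : 'rV[R]_n.+1) : 'rV[R]_n :=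
  \row_j x ord0 (lift ord0 j).

Section row_cons.
Context {R : realType} (n : nat).

Lemma row_cons0 (p : measurableTypeR R * 'rV[R]_n) :
  row_cons p ord0 ord0 = p.1.
Proof.
rewrite /row_cons (_ : ord0 = lshift n (ord0 : 'I_1)); last exact/val_inj.
by rewrite (row_mxEl (const_mx p.1 : 'rV[R]_1) p.2) mxE.
Qed.

Lemma row_consS (p : measurableTypeR R * 'rV[R]_n) (j : 'I_n) :
  row_cons p ord0 (lift ord0 j) = p.2 ord0 j.
Proof.
rewrite /row_cons (_ : lift ord0 j = rshift 1 j); last exact/val_inj.
by rewrite (row_mxEr (const_mx p.1 : 'rV[R]_1) p.2).
Qed.

Lemma row_consK (p : measurableTypeR R * 'rV[R]_n) :
  (row_cons p ord0 ord0, row_behead (row_cons p)) = p.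
Proof.
case: p => a x; rewrite row_cons0; congr pair.
by apply/rowP => j; rewrite mxE row_consS.
Qed.

Lemma measurable_row_cons : measurable_fun [set: _] (@row_cons R n).
Proof.
apply: measurable_fun_rV => i.
case: (unliftP ord0 i) => [j ->|->].
  under eq_fun do rewrite row_consS.
  exact: (measurableT_comp (measurable_coor j) measurable_snd).
by under eq_fun do rewrite row_cons0; exact: measurable_fst.
Qed.

Lemma measurable_row_behead : measurable_fun [set: _] (@row_behead R n).
Proof.
apply: measurable_fun_rV => i.
by under eq_fun do rewrite mxE; exact: measurable_coor.
Qed.

End row_cons.

Section lebesgue_rV_succ.
Context {R : realType} (n : nat)
  (mu : {sigma_finite_measure set 'rV[R]_n -> \bar R}).
Local Open Scope ereal_scope.

Definition lebesgue_rV_succ : set 'rV[R]_n.+1 -> \bar R :=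
  pushforward (@lebesgue_measure R \x mu) (@row_cons R n).

Let ls0 : lebesgue_rV_succ set0 = 0.
Proof. by rewrite /lebesgue_rV_succ /pushforward preimage_set0 measure0. Qed.

Let ls_ge0 A : 0 <= lebesgue_rV_succ A.
Proof. exact: (measure_ge0 (@lebesgue_measure R \x mu)). Qed.

Let ls_sigma_additive : semi_sigma_additive lebesgue_rV_succ.
Proof.
have mc A : measurable A -> measurable (@row_cons R n @^-1` A).
  by move=> mA; rewrite -[X in measurable X]setTI; exact: measurable_row_cons.
move=> F mF tF mUF; rewrite /lebesgue_rV_succ /pushforward preimage_bigcup.
apply: (@measure_semi_sigma_additive _ _ _ (@lebesgue_measure R \x mu)).
- by move=> k; exact: mc.
- apply/trivIsetP => i j _ _ ij; rewrite -preimage_setI.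
  by move/trivIsetP : tF => /(_ _ _ _ _ ij) ->//; rewrite preimage_set0.
- by rewrite -preimage_bigcup; exact: mc.
Qed.

HB.instance Definition _ := isMeasure.Build _ _ _ lebesgue_rV_succ
  ls0 ls_ge0 ls_sigma_additive.

Let ls_sigma_finite : sigma_finite setT lebesgue_rV_succ.
Proof.
have /sigma_finiteP[F [TF ndF Foo]] := sigma_finiteT (@lebesgue_measure R).
have /sigma_finiteP[G [TG ndG Goo]] := sigma_finiteT mu.
pose g (x : 'rV[R]_n.+1) : measurableTypeR R * 'rV[R]_n :=
  (x ord0 ord0, row_behead x).
have mg : measurable_fun setT g.
  apply/measurable_fun_pairP; split; first exact: measurable_coor.
  exact: measurable_row_behead.
exists (fun k => g @^-1` (F k `*` G k)).
  apply/seteqP; split=> // x _.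
  have [k _ Fk] : (\bigcup_k F k) (g x).1 by rewrite -TF.
  have [l _ Gl] : (\bigcup_k G k) (g x).2 by rewrite -TG.
  exists (maxn k l) => //; split.
  - by move: Fk; exact/subsetPset/ndF/leq_maxl.
  - by move: Gl; exact/subsetPset/ndG/leq_maxr.
move=> k; have [mF Fk] := Foo k; have [mG Gk] := Goo k; split.
  by rewrite -[X in measurable X]setTI; apply: mg => //; exact: measurableX.
rewrite /lebesgue_rV_succ /pushforward -comp_preimage.
rewrite (_ : g \o _ = id) ?preimage_id; last first.
  by apply/funext => p; exact: row_consK.
by rewrite product_measure1E// lte_mul_pinfty// ge0_fin_numE.
Qed.

HB.instance Definition _ := Measure_isSigmaFinite.Build _ _ _
  lebesgue_rV_succ ls_sigma_finite.

End lebesgue_rV_succ.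

(* Lebesgue measure on R^n, as the n-fold product of Lebesgue measure on R. *)
Fixpoint lebesgue_rV {R : realType} (n : nat) :
    {sigma_finite_measure set 'rV[R]_n -> \bar R} :=
  match n with
  | 0 => \d_(0 : 'rV[R]_0)
  | n'.+1 => lebesgue_rV_succ (lebesgue_rV n')
  end.

(* The value on boxes characterizes Lebesgue measure. *)
Lemma lebesgue_rV_box (R : realType) (n : nat) (A : 'I_n -> set (measurableTypeR R)) :
  (forall i, measurable (A i)) ->
  lebesgue_rV n [set x : 'rV[R]_n | forall i, A i (x ord0 i)] =
  (\prod_(i < n) lebesgue_measure (A i))%E.
Proof.
elim: n A => [|n IH] A mA.
  rewrite big_ord0 /= diracE mem_set//= => i; by case: i.
rewrite big_ord_recl -(IH (fun i => A (lift ord0 i)))//=.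
rewrite /lebesgue_rV_succ /pushforward -product_measure1E//; last first.
  rewrite (_ : [set _ | _] = \bigcap_(i : 'I_n)
      ((fun x : 'rV[R]_n => x ord0 i : measurableTypeR R) @^-1` A (lift ord0 i))).
    apply: fin_bigcap_measurable => // i _.
    by rewrite -[X in measurable X]setTI; exact: measurable_coor.
  by apply/seteqP; split=> x/= h i; [move=> _|]; exact: h.
congr (product_measure1 _ _ _); apply/seteqP; split=> p /=.
  by move=> h; split=> [|i]; [rewrite -(row_cons0 p)|rewrite -row_consS].
move=> [h0 h1] i; case: (unliftP ord0 i) => [j ->|->].
  by rewrite row_consS.
by rewrite row_cons0.
Qed.

(* Main.v *)
(** Write L = |xi|, r1 = |x|, r2 = |x - xi|, s = r1 + r2, al = c'^(1/(1-gamma)),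
    be = c^(1/(1-gamma)), th0 = al/(al+be).  A quantitative Hoelder inequality,
    obtained from Bernoulli's inequality alone, gives
      c' r1^gamma + c r2^gamma
        <= ctilde s^gamma (1 - const (r1/s - th0)^2),
    so that the exponent of the integrand is at most
      - b L + ctilde L^gamma - b/2 (s - L) - const L^gamma (r1/s - th0)^2.
    By the Gram determinant of x and x - xi, s - L controls |w|^2/L for
    x = t xi + w, and r1/s may then be replaced by t.  The integrand is thus
    concentrated on a set of length L^(1-gamma/2) along xi and width L^(1/2) in
    the N-1 transversal directions, where it has size L^(a+a') times the
    exponential, and there the estimates can be reversed.

    Rotation invariance of Lebesgue measure is avoided: up to a permutation of
    the coordinates |xi_0| >= L/sqrt N, so w can be taken in {w_0 = 0}, and the
    shear x = t xi + w needs only Tonelli and translation invariance.  As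
    L^(1/2) << L^(1-gamma/2), the obliqueness of {w_0 = 0} costs a constant. *)
From HB Require Import structures.
Require Import Defs.
From mathcomp Require Import all_boot all_order fingroup perm all_algebra.
From mathcomp Require Import all_classical all_reals all_analysis.
From mathcomp Require Import measurable_realfun ring lra.
Set Implicit Arguments.
Unset Strict Implicit.
Unset Printing Implicit Defensive.
Import Order.TTheory GRing.Theory Num.Theory.
Import numFieldNormedType.Exports.
Local Open Scope classical_set_scope.
Local Open Scope ring_scope.

(** * Lebesgue measure on row vectors *)

Definition box (R : realType) n (A : 'I_n -> set (measurableTypeR R)) :
    set 'rV[R]_n := [set x | forall i, A i (x ord0 i)].

Lemma measurable_box (R : realType) n (A : 'I_n -> set (measurableTypeR R)) :
  (forall i, measurable (A i)) -> measurable (box A).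
Proof.
move=> mA; rewrite (_ : box A = \bigcap_(i : 'I_n)
    ((fun x : 'rV[R]_n => x ord0 i : measurableTypeR R) @^-1` A i)).
  apply: fin_bigcap_measurable => // i _.
  by rewrite -[X in measurable X]setTI; exact: measurable_coor.
by apply/seteqP; split=> x/= h i; [move=> _|]; exact: h.
Qed.

Lemma lebesgue_rV_boxE (R : realType) n (A : 'I_n -> set (measurableTypeR R)) :
  (forall i, measurable (A i)) ->
  lebesgue_rV n (box A) = (\prod_(i < n) lebesgue_measure (A i))%E.
Proof. exact: lebesgue_rV_box. Qed.

(** A coordinate cylinder is a box whose other sides are the whole line. Boxes are stable under
    intersection, so measures can be compared on them alone. *)
Lemma measurable_rV_boxes (R : realType) n :
  @measurable _ 'rV[R]_n =
  <<s [set B | exists2 A : 'I_n -> set (measurableTypeR R),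
         (forall i, measurable (A i)) & B = box A] >>.
Proof.
apply/seteqP; split.
  apply: smallest_sub; first exact: smallest_sigma_algebra.
  rewrite -bigcup_seq => _ [i _ [B mB <-]].
  apply: sub_sigma_algebra; exists (fun j => if j == i then B else setT).
    by move=> j; case: ifP => _; [exact: mB|exact: measurableT].
  rewrite setTI; apply/seteqP; split => x /=.
    by move=> Bx j; case: eqP => // ->.
  by move=> /(_ i); rewrite eqxx.
apply: smallest_sub; first exact: sigma_algebra_measurable.
by move=> _ [A mA ->]; exact: measurable_box.
Qed.

(** Uniqueness on a generating pi-system: the cubes [-k, k]^n are boxes of finite measure that
    exhaust the space. *)
Lemma lebesgue_rV_unique (R : realType) n
    (m : {measure set 'rV[R]_n -> \bar R}) :
  (forall A : 'I_n -> set (measurableTypeR R), (forall i, measurable (A i)) ->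
     m (box A) = (\prod_(i < n) lebesgue_measure (A i))%E) ->
  forall E, measurable E -> lebesgue_rV n E = m E.
Proof.
move=> mbox E mE.
pose I k : set (measurableTypeR R) := `[- k%:R, k%:R]%classic.
have mI k : measurable (I k) by exact: measurable_itv.
apply: (measure_unique _ (fun k => box (fun=> I k)) (@measurable_rV_boxes R n))
  => //.
- move=> _ _ [A mA ->] [B mB ->]; exists (fun i => A i `&` B i).
    by move=> i; exact: measurableI.
  apply/seteqP; split=> x /=; first by move=> [hA hB] i; split.
  by move=> h; split=> i; have [] := h i.
- by move=> k; exists (fun=> I k).
- rewrite -subTset => x _; pose M := \sum_(i < n) `|x ord0 i|.
  exists (Num.trunc M).+1 => // i; rewrite /I/= in_itv/= -ler_norml.
  apply: le_trans (ltW (truncnS_gt M)); rewrite /M (bigD1 i)//= lerDl.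
  by apply: sumr_ge0 => j _; exact: normr_ge0.
- by move=> _ [A mA ->]; rewrite mbox// -lebesgue_rV_boxE.
- move=> k; change (lebesgue_rV n (box (fun=> I k)) < +oo)%E.
  rewrite lebesgue_rV_boxE// (eq_bigr (fun=> (k%:R + k%:R)%:E)).
    by rewrite prodEFin ltry.
  (* The length formula branches on -k < k; the other branch is k = 0, where both sides vanish. *)
  move=> i _; rewrite lebesgue_measure_itv/= lte_fin opprK; case: ltP => //.
  have -> : k%:R <= - k%:R :> R = (k == 0)%N.
    by rewrite -subr_le0 opprK -natrD lern0 addn_eq0 andbb.
  by move=> /eqP ->; rewrite addr0.
Qed.

Lemma lebesgue_measureD (R : realType) (r : R) (A : set (measurableTypeR R)) :
  measurable A -> lebesgue_measure ((fun x => x + r) @^-1` A) =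
  lebesgue_measure A.
Proof.
have mr : measurable_fun setT (fun x : measurableTypeR R => x + r : measurableTypeR R).
  exact: measurable_funD.
pose phi : {mfun measurableTypeR R >-> measurableTypeR R} :=
  HB.pack (fun x : measurableTypeR R => x + r : measurableTypeR R)
    (isMeasurableFun.Build _ _ _ _ _ mr).
move=> mA; apply/esym.
apply: (lebesgue_measure_unique (mu := pushforward lebesgue_measure phi)) => //.
move=> _ [[a b]] _ <-; rewrite /= /pushforward.
rewrite (_ : _ @^-1` _ = `](a - r), (b - r)]%classic); last first.
  by apply/seteqP; split=> x /=; rewrite !in_itv/= ltrBlDr lerBrDr.
rewrite !lebesgue_measure_itv/= !lte_fin ltrD2r; case: ifP => // _.
by rewrite -!EFinD; congr EFin; ring.
Qed.

Section lebesgue_rV_invariance.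
Context {R : realType} (n : nat).
Implicit Types (f : 'rV[R]_n -> \bar R).

Lemma measurable_rV_addr (w : 'rV[R]_n) :
  measurable_fun setT (fun x : 'rV[R]_n => x + w).
Proof.
apply: measurable_fun_rV => i; under eq_fun do rewrite mxE.
by apply: measurable_funD => //; exact: measurable_coor.
Qed.

Lemma measurable_rV_col_perm (s : 'S_n) :
  measurable_fun setT (@col_perm R 1 n s).
Proof.
by apply: measurable_fun_rV => i; under eq_fun do rewrite mxE; exact: measurable_coor.
Qed.

(** By uniqueness on boxes, the image of Lebesgue measure under [phi] is Lebesgue measure. This
    serves both translations and permutations of the coordinates. *)
Lemma lebesgue_rV_pushforward (phi : 'rV[R]_n -> 'rV[R]_n) f :
  measurable_fun setT phi ->
  (forall A : 'I_n -> set (measurableTypeR R), (forall i, measurable (A i)) ->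
    lebesgue_rV n (phi @^-1` box A) = (\prod_(i < n) lebesgue_measure (A i))%E) ->
  measurable_fun setT f -> (forall x, 0 <= f x)%E ->
  (\int[lebesgue_rV n]_x f (phi x) = \int[lebesgue_rV n]_x f x)%E.
Proof.
move=> mphi hphi mf f0.
pose ph : {mfun 'rV[R]_n >-> 'rV[R]_n} :=
  HB.pack phi (isMeasurableFun.Build _ _ _ _ _ mphi).
rewrite [RHS](eq_measure_integral (pushforward (lebesgue_rV n) ph)).
  by rewrite ge0_integral_pushforward.
by move=> A mA _; exact: (@lebesgue_rV_unique R n (pushforward (lebesgue_rV n) ph)).
Qed.

Lemma integral_rV_addr (w : 'rV[R]_n) f :
  measurable_fun setT f -> (forall x, 0 <= f x)%E ->
  (\int[lebesgue_rV n]_x f (x + w)%R = \int[lebesgue_rV n]_x f x)%E.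
Proof.
apply: lebesgue_rV_pushforward; first exact: measurable_rV_addr.
move=> A mA; pose B i : set (measurableTypeR R) := (fun x => x + w ord0 i) @^-1` A i.
rewrite (_ : _ @^-1` _ = box B).
  rewrite lebesgue_rV_boxE => [|i].
    by apply: eq_bigr => i _; rewrite lebesgue_measureD.
  rewrite -[X in measurable X]setTI; move: (mA i).
  have: measurable_fun setT (fun x : measurableTypeR R => x + w ord0 i).
    exact: measurable_funD.
  by apply.
by apply/seteqP; split=> x /= h i; have := h i; rewrite /B/= mxE.
Qed.

Lemma integral_rV_col_perm (s : 'S_n) f :
  measurable_fun setT f -> (forall x, 0 <= f x)%E ->
  (\int[lebesgue_rV n]_x f (col_perm s x) = \int[lebesgue_rV n]_x f x)%E.
Proof.
apply: lebesgue_rV_pushforward; first exact: measurable_rV_col_perm.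
move=> A mA; rewrite (_ : _ @^-1` _ = box (fun i => A ((s^-1)%g i))).
  rewrite lebesgue_rV_boxE => [|//].
  by rewrite [RHS](reindex_inj (@perm_inj _ (s^-1)%g)).
apply/seteqP; split=> x /= h i; last by have := h (s i); rewrite mxE permK.
by have := h ((s^-1)%g i); rewrite mxE permKV.
Qed.

End lebesgue_rV_invariance.

Lemma integral_rV_succ (R : realType) n (f : 'rV[R]_n.+1 -> \bar R) :
  measurable_fun setT f -> (forall x, 0 <= f x)%E ->
  (\int[lebesgue_rV n.+1]_x f x =
   \int[lebesgue_measure]_t \int[lebesgue_rV n]_y f (row_cons (t, y)))%E.
Proof.
move=> mf f0; rewrite [LHS]/= /lebesgue_rV_succ ge0_integral_pushforward//=.
  rewrite preimage_setT fubini_tonelli1//.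
  exact: (measurableT_comp mf (@measurable_row_cons R n)).
exact: measurable_row_cons.
Qed.

Lemma integral_rV_prod (R : realType) n (k : R -> R) (c : R) :
  measurable_fun setT k -> (forall x, 0 <= k x) ->
  (\int[lebesgue_measure]_x (k x)%:E = c%:E)%E ->
  (\int[lebesgue_rV n]_y (\prod_(i < n) k (y ord0 i))%:E = (c ^+ n)%:E)%E.
Proof.
move=> mk k0 kc; elim: n => [|n IH].
  rewrite (eq_integral (cst 1%E)) => [|y _]; last by rewrite big_ord0.
  by rewrite integral_cst//= diracE in_setT mule1 expr0.
have mprod m : measurable_fun setT (fun y : 'rV[R]_m => \prod_(i < m) k (y ord0 i)).
  apply: measurable_prod => i _.
  exact: (measurableT_comp mk (measurable_coor i)).
have prod0 m (y : 'rV[R]_m) : 0 <= \prod_(i < m) k (y ord0 i) by exact: prodr_ge0.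
rewrite integral_rV_succ; first last.
- by move=> y; rewrite lee_fin.
- by apply/measurable_EFinP; exact: mprod.
under eq_integral => t _.
  under eq_integral => y _.
    rewrite big_ord_recl row_cons0; under eq_bigr do rewrite row_consS.
    rewrite EFinM /=; over.
  rewrite ge0_integralZl//; first last.
  - by rewrite lee_fin.
  - by move=> y _; rewrite lee_fin; exact: prod0.
  - by apply/measurable_EFinP; exact: mprod.
  rewrite IH; over.
rewrite ge0_integralZr//; first last.
- rewrite lee_fin exprn_ge0// -lee_fin -kc.
  by apply: integral_ge0 => x _; rewrite lee_fin.
- by move=> x _; rewrite lee_fin.
- exact/measurable_EFinP.
by rewrite kc -EFinM exprS.
Qed.

(** On each slice of fixed t the shear is a translation by t w, so Tonelli and translation
    invariance replace a determinant. *)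
Lemma integral_shear (R : realType) n (w : 'rV[R]_n) (f : 'rV[R]_n.+1 -> \bar R) :
  measurable_fun setT f -> (forall x, 0 <= f x)%E ->
  (\int[lebesgue_rV n.+1]_x f x =
   \int[lebesgue_measure]_t \int[lebesgue_rV n]_y f (row_cons (t, (y + t *: w)%R)))%E.
Proof.
move=> mf f0; rewrite integral_rV_succ//; apply: eq_integral => t _.
rewrite (integral_rV_addr (t *: w) (f := fun y => f (row_cons (t, y))))//.
apply: (measurableT_comp mf).
apply: (measurableT_comp (@measurable_row_cons R n)).
exact: measurable_pair1.
Qed.

Section shear_bounds.
Context {R : realType} (n : nat) (w : 'rV[R]_n).
Variables (f : 'rV[R]_n.+1 -> R) (k0 k : R -> R) (C c0 c : R).
Hypotheses (mf : measurable_fun setT f) (f0 : forall x, 0 <= f x).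
Hypotheses (mk0 : measurable_fun setT k0) (k00 : forall x, 0 <= k0 x)
  (ik0 : (\int[lebesgue_measure]_x (k0 x)%:E = c0%:E)%E).
Hypotheses (mk : measurable_fun setT k) (k_ge0 : forall x, 0 <= k x)
  (ik : (\int[lebesgue_measure]_x (k x)%:E = c%:E)%E).
Hypothesis C0 : 0 <= C.

(** A product kernel in the sheared coordinates. Its iterated integral is explicit, so a pointwise
    comparison with [G] bounds the integral of [f] from either side. *)
Let G (t : R) (y : 'rV[R]_n) := C * k0 t * \prod_(i < n) k (y ord0 i).

Let mprod : measurable_fun setT (fun y : 'rV[R]_n => \prod_(i < n) k (y ord0 i)).
Proof.
apply: measurable_prod => i _.
exact: (measurableT_comp mk (measurable_coor i)).
Qed.

Let prod0 (y : 'rV[R]_n) : 0 <= \prod_(i < n) k (y ord0 i).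
Proof. exact: prodr_ge0. Qed.

Let innerG t : (\int[lebesgue_rV n]_y (G t y)%:E = (C * k0 t * c ^+ n)%:E)%E.
Proof.
rewrite /G; under eq_integral do rewrite EFinM.
rewrite ge0_integralZl//; first last.
- by rewrite lee_fin mulr_ge0.
- by move=> y _; rewrite lee_fin.
- exact/measurable_EFinP.
by rewrite (integral_rV_prod n mk k_ge0 ik) -EFinM.
Qed.

Let outerG : (\int[lebesgue_measure]_t (C * k0 t * c ^+ n)%:E =
  (C * c0 * c ^+ n)%:E)%E.
Proof.
have cn0 : 0 <= C * c ^+ n.
  rewrite mulr_ge0// exprn_ge0// -lee_fin -ik.
  by apply: integral_ge0 => x _; rewrite lee_fin.
under eq_integral do rewrite mulrAC EFinM.
rewrite ge0_integralZl//; first last.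
- by move=> y _; rewrite lee_fin.
- exact/measurable_EFinP.
by rewrite ik0 -EFinM mulrAC.
Qed.

Let mfpair : measurable_fun setT
  (fun p : measurableTypeR R * 'rV[R]_n => (f (row_cons (p.1, (p.2 + p.1 *: w)%R)))%:E).
Proof.
apply/measurable_EFinP; apply: (measurableT_comp mf).
apply: (measurableT_comp (@measurable_row_cons R n)).
apply/measurable_fun_pairP; split; first exact: measurable_fst.
apply: measurable_fun_rV => i; under eq_fun do rewrite !mxE.
apply: measurable_funD.
  exact: (measurableT_comp (measurable_coor i) measurable_snd).
by apply: measurable_funM => //; exact: measurable_fst.
Qed.

Let minner t : measurable_fun setT
  (fun y : 'rV[R]_n => (f (row_cons (t, (y + t *: w)%R)))%:E).
Proof. exact: (measurableT_comp mfpair (measurable_pair1 t)). Qed.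

Let mG t : measurable_fun setT (fun y => (G t y)%:E).
Proof. by apply/measurable_EFinP; exact: measurable_funM. Qed.

Let mC : measurable_fun setT (fun t => (C * k0 t * c ^+ n)%:E).
Proof. by apply/measurable_EFinP; do 2 apply: measurable_funM => //. Qed.

Let mF : measurable_fun setT (fun t : measurableTypeR R =>
  \int[lebesgue_rV n]_y (f (row_cons (t, (y + t *: w)%R)))%:E)%E.
Proof. by apply: (measurable_fun_fubini_tonelli_F _ mfpair) => p; rewrite lee_fin. Qed.

Let mf' : measurable_fun setT (EFin \o f).
Proof. exact/measurable_EFinP. Qed.

Lemma le_integral_shear :
  (forall t (y : 'rV[R]_n), f (row_cons (t, (y + t *: w)%R)) <=
     C * k0 t * \prod_(i < n) k (y ord0 i)) ->
  (\int[lebesgue_rV n.+1]_x (f x)%:E <= (C * c0 * c ^+ n)%:E)%E.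
Proof.
move=> fG; rewrite (integral_shear w mf') => [|x]; last by rewrite lee_fin.
rewrite -outerG; apply: ge0_le_integral => //.
  by move=> t _; apply: integral_ge0 => y _; rewrite lee_fin.
move=> t _; rewrite -innerG; apply: ge0_le_integral => //.
- by move=> y _; rewrite lee_fin.
- exact: (minner t).
- by move=> y _; rewrite lee_fin.
Qed.

Lemma ge_integral_shear :
  (forall t (y : 'rV[R]_n), C * k0 t * \prod_(i < n) k (y ord0 i) <=
     f (row_cons (t, (y + t *: w)%R))) ->
  ((C * c0 * c ^+ n)%:E <= \int[lebesgue_rV n.+1]_x (f x)%:E)%E.
Proof.
move=> fG; rewrite (integral_shear w mf') => [|x]; last by rewrite lee_fin.
rewrite -outerG; apply: ge0_le_integral => //.
  move=> t _; rewrite -innerG; apply: integral_ge0 => y _.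
  by rewrite lee_fin !mulr_ge0//; exact: prod0.
move=> t _; rewrite -innerG; apply: ge0_le_integral => //.
- by move=> y _; rewrite lee_fin !mulr_ge0//; exact: prod0.
- exact: (minner t).
- by move=> y _; rewrite lee_fin; exact: fG.
Qed.

End shear_bounds.

(** * The kernel 1 / (1 + x^2) *)

Lemma integral_oneDsqrV (R : realType) :
  (\int[lebesgue_measure]_x ((oneDsqr x)^-1)%:E = (pi : R)%:E)%E.
Proof.
rewrite (@ge0_symfun_integralT R (fun x => (oneDsqr x)^-1)).
- rewrite -set_itvcy integral0y_oneDsqr -EFinM; congr EFin.
  by rewrite mulrC divfK.
- by move=> x; rewrite invr_ge0 ltW// oneDsqr_gt0.
- exact: continuous_oneDsqrV.
- by move=> x; rewrite /= /oneDsqr sqrrN.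
Qed.

(** One such kernel per coordinate majorises the integrand; its mass is proportional to the width s,
    which produces the powers of L. *)
Lemma integral_oneDsqrV_affine (R : realType) (m s : R) : 0 < s ->
  (\int[lebesgue_measure]_x ((oneDsqr ((x - m) / s))^-1)%:E = (pi * s)%:E)%E.
Proof.
move=> s0; pose F (x : R^o) : R^o := (x - m) / s.
have F'E : F^`()%classic = cst s^-1.
  apply/funext => x; rewrite /F derive1E deriveM// deriveD// derive_cst scaler0.
  by rewrite add0r derive_id derive_cst addr0 scaler1.
have subst : (\int[lebesgue_measure]_x
    (((fun z => (oneDsqr z)^-1) \o F) x * s^-1)%:E = (pi : R)%:E)%E.
  rewrite -integral_oneDsqrV
    (@increasing_ge0_integration_by_substitutionT R F (fun z => (oneDsqr z)^-1)).
  - by apply: eq_integral => x _; rewrite F'E.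
  - by move=> x y xy; rewrite /F ltr_pM2r ?invr_gt0// ltrD2r.
  - by rewrite F'E => ?; exact: cvg_cst.
  - by rewrite F'E; exact: is_cvg_cst.
  - by rewrite F'E; exact: is_cvg_cst.
  - by move=> x; apply: derivableM.
  - by apply/gt0_cvgMlNy; [rewrite invr_gt0|exact: cvg_addrr_Ny].
  - by apply/gt0_cvgMly; [rewrite invr_gt0|exact: cvg_addrr].
  - exact: continuous_oneDsqrV.
  - by move=> x; rewrite invr_ge0 ltW// oneDsqr_gt0.
have mK : measurable_fun setT (fun x : R => (oneDsqr (F x))^-1).
  apply: (measurableT_comp (continuous_measurable_fun (@continuous_oneDsqrV R))).
  by apply: measurable_funM => //; exact: measurable_funD.
rewrite EFinM -subst muleC.
under [in RHS]eq_integral do rewrite mulrC EFinM.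
rewrite ge0_integralZl//; first last.
- by rewrite lee_fin invr_ge0 ltW.
- by move=> x _; rewrite lee_fin invr_ge0 ltW// oneDsqr_gt0.
- exact/measurable_EFinP.
by rewrite muleA -EFinM divff ?mul1e// gt_eqF.
Qed.

(** * Powers and the quantitative Hoelder inequality *)

Section power_estimates.
Context {R : realType}.
Implicit Types x y z r g : R.
Lemma powR_div x y r : 0 <= x -> 0 < y -> (x / y) `^ r = x `^ r / y `^ r.
Proof.
move=> x0 y0; have yr : y `^ r != 0 by rewrite gt_eqF// powR_gt0.
apply: (mulIf yr); rewrite divfK// -powRM//; last exact: ltW.
  by rewrite divfK// gt_eqF.
by rewrite divr_ge0// ltW.
Qed.

Lemma powR_inv x r : 0 <= x -> x^-1 `^ r = (x `^ r)^-1.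
Proof. by move=> x0; rewrite -powR_inv1// powRAC powR_inv1// powR_ge0. Qed.

(** Young's inequality for the product of x^g and 1, with conjugate exponents 1/g and 1/(1-g). *)
Lemma powR_Bernoulli g x : 0 < g < 1 -> 0 <= x -> x `^ g <= 1 + g * (x - 1).
Proof.
move=> /andP[g0 g1] x0.
have h : g^-1^-1 + (1 - g)^-1^-1 = 1 by rewrite !invrK; ring.
have := @conjugate_powR R (x `^ g) 1 g^-1 (1 - g)^-1 (powR_ge0 _ _) ler01 _ _ h.
rewrite !invr_gt0 subr_gt0 => /(_ g0 g1).
rewrite mulr1 powR1 -powRrM divff ?gt_eqF// powRr1// !invrK.
by move=> /le_trans; apply; lra.
Qed.

(* Bernoulli applied to m and to z / m, with m the midpoint of 1 and z. *)
Lemma powR_le_quadratic g z : 0 < g < 1 -> 0 <= z ->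
  z `^ g <= 1 + g * (z - 1) - g * (1 - g) * (z - 1) ^+ 2 / (2 * (1 + z)).
Proof.
move=> g01 z0; have /andP[g0 g1] := g01.
pose m := (1 + z) / 2; have m0 : 0 < m by rewrite /m; lra.
have zm0 : 0 <= z / m by rewrite divr_ge0// ltW.
have -> : z `^ g = m `^ g * (z / m) `^ g.
  by rewrite -powRM ?(ltW m0)// mulrC divfK// gt_eqF.
have Hm := powR_Bernoulli g01 (ltW m0).
have Hz := powR_Bernoulli g01 zm0.
apply: (le_trans (ler_pM (powR_ge0 _ _) (powR_ge0 _ _) Hm Hz)).
rewrite le_eqVlt; apply/orP; left; apply/eqP; rewrite /m.
by field; lra.
Qed.

(** Write z^g = z / z^(1-g) and bound the denominator by Bernoulli with exponent 1-g. *)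
Lemma powR_ge_quadratic g z : 0 < g < 1 -> 2^-1 <= z ->
  1 + g * (z - 1) - 2 * (z - 1) ^+ 2 <= z `^ g.
Proof.
move=> g01 z2; have /andP[g0 g1] := g01.
have z0 : 0 < z by apply: lt_le_trans z2; rewrite invr_gt0.
have g01' : 0 < 1 - g < 1 by lra.
have H := powR_Bernoulli g01' (ltW z0).
have -> : z `^ g = z / z `^ (1 - g).
  rewrite -[X in X / _](powRr1 (ltW z0)) -powRB; last by rewrite (gt_eqF z0) implybT.
  by congr powR; ring.
have z1g : 0 < z `^ (1 - g) by exact: powR_gt0.
rewrite ler_pdivlMr//.
(* When the quadratic is negative the claim is trivial; otherwise it may multiply the Bernoulli
   bound. *)
have [h|h] := lerP 0 (1 + g * (z - 1) - 2 * (z - 1) ^+ 2); last first.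
  by apply: ltW; apply: lt_trans z0; rewrite nmulr_rlt0.
apply: (le_trans (ler_wpM2l h H)); rewrite -subr_ge0.
pose w := z - 1.
have -> : z - (1 + g * (z - 1) - 2 * (z - 1) ^+ 2) * (1 + (1 - g) * (z - 1)) =
  w ^+ 2 * (2 - g * (1 - g) + 2 * (1 - g) * w) by rewrite /w; ring.
apply: mulr_ge0; first exact: sqr_ge0.
(* As w >= -1/2, the second factor is at least 1 + g^2. *)
by rewrite /w; nra.
Qed.

Lemma powR_le_expR k c : 0 <= k -> 0 < c ->
  exists2 C, 0 < C & forall x, 0 <= x -> (1 + x) `^ k <= C * expR (c * x).
Proof.
move=> k0 c0; have k1 : 0 < k + 1 by lra.
(* Chosen so that 1 + x <= M (1 + c x / (k+1)) <= M e^(c x / (k+1)). The exponent k+1 avoids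
   dividing by k = 0. *)
pose M := 1 + (k + 1) / c.
have M1 : 1 <= M by rewrite /M lerDl divr_ge0// ltW.
have M0 : 0 < M by lra.
exists (M `^ (k + 1)); first exact: powR_gt0.
move=> x x0; apply: (@le_trans _ _ ((1 + x) `^ (k + 1))).
  by apply: ler_powR; lra.
have -> : expR (c * x) = expR (c * x / (k + 1)) `^ (k + 1).
  by rewrite -expRM divfK ?gt_eqF.
rewrite -powRM ?expR_ge0 ?(ltW M0)//.
apply: ge0_ler_powR; rewrite ?nnegrE ?mulr_ge0 ?expR_ge0 ?(ltW M0) ?(ltW k1)//.
  by lra.
apply: (@le_trans _ _ (M * (1 + c * x / (k + 1)))); last first.
  by rewrite ler_pM2l// expR_ge1Dx.
have -> : M * (1 + c * x / (k + 1)) =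
    1 + x + (k + 1) / c + c * x / (k + 1).
  by rewrite /M; field; rewrite !gt_eqF.
rewrite -addrA lerDl addr_ge0// divr_ge0 ?mulr_ge0// ltW//.
Qed.

(** The sign of a decides which of the two bounds on x is used; |a| in the constant covers both
    cases. *)
Lemma powR_comparable a x y M : 0 < x -> 0 < y -> 1 <= M ->
  y / M <= x <= M * y -> x `^ a <= M `^ `|a| * y `^ a.
Proof.
move=> x0 y0 M1 /andP[h1 h2]; have M0 : 0 < M by lra.
rewrite -ler_pdivrMr ?powR_gt0// -powR_div ?(ltW x0)//.
have xy0 : 0 < x / y by exact: divr_gt0.
have [a0|a0] := leP 0 a.
  rewrite ger0_norm//; apply: ge0_ler_powR => //; rewrite ?nnegrE ?(ltW xy0) ?(ltW M0)//.
  by rewrite ler_pdivrMr.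
rewrite ltr0_norm// -[a in X in X <= _]opprK powRN -powR_inv ?(ltW xy0)//.
apply: ge0_ler_powR; rewrite ?nnegrE ?invr_ge0 ?(ltW xy0) ?(ltW M0)//.
  by rewrite oppr_ge0 ltW.
by rewrite invf_div ler_pdivrMr// -ler_pdivrMl// mulrC.
Qed.

End power_estimates.

(** * Two-sided quadratic defect in Hoelder's inequality *)

Section hoelder_defect.
Context {R : realType}.
Variables (al be g : R).
Hypotheses (al0 : 0 < al) (be0 : 0 < be) (g01 : 0 < g < 1).

Lemma powR_homogeneous (x r : R) : 0 < x -> 0 <= r ->
  x `^ (1 - g) * r `^ g = x * (r / x) `^ g.
Proof.
move=> x0 r0; rewrite powR_div// powRB ?(gt_eqF x0) ?implybT// powRr1 ?(ltW x0)//.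
by rewrite mulrAC mulrA.
Qed.

Let S := al + be.
Let S0 : 0 < S. Proof. exact: addr_gt0. Qed.

Section defect.
Variables (r1 r2 : R).
Hypotheses (r10 : 0 <= r1) (r20 : 0 <= r2) (s0 : 0 < r1 + r2).
Let s := r1 + r2.
(** Equality in Hoelder holds when r1 / al = r2 / be, and the common value is then [sg]. Hence [z1]
    and [z2] measure the deviation from equality, where both are 1. *)
Let sg := s / S.
Let sg0 : 0 < sg. Proof. exact: divr_gt0. Qed.
Let z1 := r1 / al / sg.
Let z2 := r2 / be / sg.
Let z10 : 0 <= z1. Proof. by rewrite !divr_ge0// ltW. Qed.
Let z20 : 0 <= z2. Proof. by rewrite !divr_ge0// ltW. Qed.

Let z12 : al * z1 + be * z2 = S.
Proof.
rewrite /z1 /z2 /sg /s; field.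
by rewrite !gt_eqF.
Qed.

Let z1E : al * (z1 - 1) = S * (r1 / (r1 + r2) - al / (al + be)).
Proof.
rewrite /z1 /sg /s /S; field.
by rewrite !gt_eqF.
Qed.

Let lhsE : al `^ (1 - g) * r1 `^ g + be `^ (1 - g) * r2 `^ g =
  sg `^ g * (al * z1 `^ g + be * z2 `^ g).
Proof.
rewrite !powR_homogeneous//.
have -> : r1 / al = sg * z1 by rewrite [RHS]mulrC divfK// gt_eqF.
have -> : r2 / be = sg * z2 by rewrite [RHS]mulrC divfK// gt_eqF.
by rewrite (powRM g (ltW sg0) z10) (powRM g (ltW sg0) z20); ring.
Qed.

Let rhsE : (al + be) `^ (1 - g) * (r1 + r2) `^ g = sg `^ g * S.
Proof. by rewrite powR_homogeneous ?(ltW s0)// mulrC. Qed.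

(** Use the quadratic bound for [z1] and plain Bernoulli for [z2]: by [z12] the linear terms cancel,
    and al z1 <= S turns the remaining square into a multiple of e^2. *)
Lemma hoelder_defect_le :
  al `^ (1 - g) * r1 `^ g + be `^ (1 - g) * r2 `^ g <=
  (al + be) `^ (1 - g) * (r1 + r2) `^ g *
    (1 - g * (1 - g) / 4 * (r1 / (r1 + r2) - al / (al + be)) ^+ 2).
Proof.
rewrite lhsE rhsE -mulrA ler_wpM2l ?powR_ge0//.
have /andP[g0 g1] := g01.
have z1e0 := z1E; set e := r1 / _ - _ in z1e0 *.
have H2 := powR_Bernoulli g01 z20; rewrite -(ler_pM2l be0) in H2.
have H1 := powR_le_quadratic g01 z10; rewrite -(ler_pM2l al0) in H1.
apply: (le_trans (lerD H1 H2)); rewrite -subr_ge0.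
have z1S : al * z1 <= S by rewrite -z12 lerDl mulr_ge0// ltW.
have -> : S * (1 - g * (1 - g) / 4 * e ^+ 2) -
   (al * (1 + g * (z1 - 1) - g * (1 - g) * (z1 - 1) ^+ 2 / (2 * (1 + z1))) +
    be * (1 + g * (z2 - 1))) =
   g * (1 - g) * (al * (z1 - 1) ^+ 2 / (2 * (1 + z1)) - S * e ^+ 2 / 4)
   + g * (S - (al * z1 + be * z2)).
  rewrite /S; field.
  by rewrite gt_eqF// ltr_wpDr.
rewrite z12 subrr mulr0 addr0; apply: mulr_ge0; first by rewrite mulr_ge0//; lra.
have -> : S * e ^+ 2 / 4 = (al * (z1 - 1)) ^+ 2 / (4 * S).
  by rewrite z1e0; field; rewrite gt_eqF.
have -> : al * (z1 - 1) ^+ 2 / (2 * (1 + z1)) - (al * (z1 - 1)) ^+ 2 / (4 * S) =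
   al * (z1 - 1) ^+ 2 * (2 * S - al * (1 + z1)) / (4 * S * (1 + z1)).
  by field; rewrite !gt_eqF// ltr_wpDr.
have alS : al <= S by rewrite lerDl ltW.
apply: divr_ge0; last by rewrite !mulr_ge0 ?(ltW S0)// addr_ge0.
by apply: mulr_ge0; [rewrite mulr_ge0 ?sqr_ge0// ltW|lra].
Qed.

(** The two ratio conditions say that [z1] and [z2] are at least 1/2, so the quadratic lower bound
    applies to both; the linear terms cancel again. *)
Lemma hoelder_defect_ge :
  al / (al + be) / 2 <= r1 / (r1 + r2) ->
  be / (al + be) / 2 <= r2 / (r1 + r2) ->
  (al + be) `^ (1 - g) * (r1 + r2) `^ g *
    (1 - 2 * (S / al + S / be) * (r1 / (r1 + r2) - al / (al + be)) ^+ 2) <=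
  al `^ (1 - g) * r1 `^ g + be `^ (1 - g) * r2 `^ g.
Proof.
move=> h1 h2; rewrite lhsE rhsE -mulrA ler_wpM2l ?powR_ge0//.
have z1e0 := z1E; set e := r1 / _ - _ in z1e0 *.
have hz1 : 2^-1 <= z1.
  have -> : z1 = r1 / (r1 + r2) / (al / (al + be)).
    by rewrite /z1 /sg /S /s; field; rewrite !gt_eqF.
  by rewrite ler_pdivlMr ?divr_gt0// mulrC.
have hz2 : 2^-1 <= z2.
  have -> : z2 = r2 / (r1 + r2) / (be / (al + be)).
    by rewrite /z2 /sg /S /s; field; rewrite !gt_eqF.
  by rewrite ler_pdivlMr ?divr_gt0// mulrC.
have H2 := powR_ge_quadratic g01 hz2; rewrite -(ler_pM2l be0) in H2.
have H1 := powR_ge_quadratic g01 hz1; rewrite -(ler_pM2l al0) in H1.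
apply: le_trans (lerD H1 H2).
have z2E : be * (z2 - 1) = - (S * e).
  by rewrite -z1e0; have := z12; rewrite /S => z12'; lra.
have z1e : z1 - 1 = S * e / al by rewrite -z1e0 mulrC mulKf// gt_eqF.
have z2e : z2 - 1 = - (S * e) / be by rewrite -z2E mulrC mulKf// gt_eqF.
rewrite z1e z2e le_eqVlt; apply/orP; left; apply/eqP.
by rewrite /S; field; rewrite !gt_eqF.
Qed.

End defect.
End hoelder_defect.

(** * Geometry of the two foci *)

(* The position of x relative to the foci 0 and xi, for x = t xi + w:
   L = |xi|, r1 = |x|, r2 = |x - xi|, d = <w, xi>, q = |w| ^ 2; the last field
   says that w is transversal to xi, with K depending on the angle. *)
Record bipolar (R : realType) (K L r1 r2 t d q : R) : Prop := Bipolar {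
  bipolar_r1_ge0 : 0 <= r1;
  bipolar_r2_ge0 : 0 <= r2;
  bipolar_q_ge0 : 0 <= q;
  bipolar_r1E : r1 ^+ 2 = t ^+ 2 * L ^+ 2 + 2 * t * d + q;
  bipolar_r2E : r2 ^+ 2 = (1 - t) ^+ 2 * L ^+ 2 - 2 * (1 - t) * d + q;
  bipolar_angle : K * d ^+ 2 <= (K - 1) * q * L ^+ 2
}.

Section bipolar.
Context {R : realType}.
Variables (K L r1 r2 t d q : R).
Hypotheses (K1 : 1 <= K) (L0 : 0 < L) (r10 : 0 <= r1) (r20 : 0 <= r2) (q0 : 0 <= q).
Hypothesis r1E : r1 ^+ 2 = t ^+ 2 * L ^+ 2 + 2 * t * d + q.
Hypothesis r2E : r2 ^+ 2 = (1 - t) ^+ 2 * L ^+ 2 - 2 * (1 - t) * d + q.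
Hypothesis dq : K * d ^+ 2 <= (K - 1) * q * L ^+ 2.

Let s := r1 + r2.
Let th := r1 / s.

Let K0 : 0 < K. Proof. exact: lt_le_trans K1. Qed.
Let qL0 : 0 <= q * L ^+ 2. Proof. by rewrite mulr_ge0 ?sqr_ge0. Qed.

Lemma bipolar_gram_lb : q * L ^+ 2 <= K * (q * L ^+ 2 - d ^+ 2).
Proof.
rewrite -subr_ge0.
have -> : K * (q * L ^+ 2 - d ^+ 2) - q * L ^+ 2 =
  (K - 1) * q * L ^+ 2 - K * d ^+ 2 by ring.
by rewrite subr_ge0.
Qed.

Let gram0 : 0 <= q * L ^+ 2 - d ^+ 2.
Proof. by rewrite -(pmulr_rge0 _ K0) (le_trans qL0) ?bipolar_gram_lb. Qed.

Lemma bipolar_CS : d ^+ 2 <= q * L ^+ 2.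
Proof. by rewrite -subr_ge0. Qed.

(* With X = <x, x - xi>, both sides of [s ^ 2 - L ^ 2 = 2 (r1 r2 + X)] are
   multiplied by [r1 r2 - X]; the product is the Gram determinant. *)
Let bipolar_sqr : L ^+ 2 <= s ^+ 2 /\
  4 * (q * L ^+ 2 - d ^+ 2) <= s ^+ 2 * (s ^+ 2 - L ^+ 2).
Proof.
pose X := (r1 ^+ 2 + r2 ^+ 2 - L ^+ 2) / 2; pose P := r1 * r2.
have P0 : 0 <= P by exact: mulr_ge0.
have PX : (P - X) * (P + X) = q * L ^+ 2 - d ^+ 2.
  have -> : (P - X) * (P + X) = r1 ^+ 2 * r2 ^+ 2 - X ^+ 2 by rewrite /P; ring.
  by rewrite /X r1E r2E; field.
have s2E : s ^+ 2 - L ^+ 2 = 2 * (P + X) by rewrite /P /X /s; field.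
have XP : `|X| <= P.
  rewrite -(ger0_norm P0) -ler_sqr ?nnegrE// !real_normK ?num_real//.
  by rewrite -subr_ge0 subr_sqr PX.
have /andP[X1 X2] : - P <= X <= P by rewrite -ler_norml.
have Ps : 4 * P <= s ^+ 2.
  by rewrite -subr_ge0 (_ : _ - _ = (r1 - r2) ^+ 2) ?sqr_ge0// /s /P; ring.
rewrite -subr_ge0 s2E -PX; split; first by lra.
have -> : 4 * ((P - X) * (P + X)) = (2 * (P - X)) * (2 * (P + X)) by ring.
apply: ler_wpM2r; first by lra.
by lra.
Qed.

Lemma bipolar_gram : 4 * (q * L ^+ 2 - d ^+ 2) <= s ^+ 2 * (s ^+ 2 - L ^+ 2).
Proof. by have [] := bipolar_sqr. Qed.

Lemma bipolar_triangle : L <= s.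
Proof.
by have [] := bipolar_sqr; rewrite ler_sqr ?nnegrE ?(ltW L0)// addr_ge0.
Qed.

(** For s <= 2L the right side of [bipolar_gram] is at most (2L)^2 (3L) (s - L), while its left side
    is at least 4 q L^2 / K. *)
Lemma bipolar_transversal : s <= 2 * L -> q <= 3 * K * L * (s - L).
Proof.
have [hK hL] := (K1, L0); have [hr1 hr2] := (r10, r20).
move=> s2L; have Ls := bipolar_triangle.
have h : s ^+ 2 * (s ^+ 2 - L ^+ 2) <= 12 * L ^+ 3 * (s - L).
  have -> : 12 * L ^+ 3 * (s - L) = (2 * L) ^+ 2 * ((3 * L) * (s - L)) by ring.
  have -> : s ^+ 2 - L ^+ 2 = (s + L) * (s - L) by ring.
  apply: ler_pM; rewrite ?sqr_ge0 ?mulr_ge0//; try lra.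
  - by rewrite ler_sqr ?nnegrE//; lra.
  - by apply: ler_wpM2r; lra.
have L2 : 0 < L ^+ 2 by rewrite exprn_gt0.
rewrite -(ler_pM2r L2); apply: (le_trans bipolar_gram_lb).
have -> : 3 * K * L * (s - L) * L ^+ 2 = K * (3 * L ^+ 3 * (s - L)) by ring.
rewrite ler_pM2l//; have := bipolar_gram.
have e : 12 * L ^+ 3 * (s - L) = 4 * (3 * L ^+ 3 * (s - L)) by ring.
by move: h; rewrite e; lra.
Qed.

Let s0 : 0 < s. Proof. by apply: lt_le_trans bipolar_triangle. Qed.

(** Subtracting the two focal equations gives t from r1^2 - r2^2, which equals s^2 (2 th - 1). *)
Lemma bipolar_longitudinal :
  t - th = (s ^+ 2 / L ^+ 2 - 1) * (th - 1 / 2) - d / L ^+ 2.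
Proof.
have L2 : L ^+ 2 != 0 by rewrite gt_eqF// exprn_gt0.
have tE : t = (r1 ^+ 2 - r2 ^+ 2 + L ^+ 2 - 2 * d) / 2 / L ^+ 2.
  by rewrite r1E r2E; field; rewrite gt_eqF.
rewrite {1}tE /th /s; field.
by rewrite !gt_eqF.
Qed.

(** The Gram determinant of w and xi is L^2 times the squared distance from x to the line R xi,
    hence at most L^2 |x|^2. *)
Lemma bipolar_q_le : q <= K * r1 ^+ 2.
Proof.
have L2 : 0 < L ^+ 2 by rewrite exprn_gt0.
rewrite -(ler_pM2r L2); apply: (le_trans bipolar_gram_lb).
rewrite -mulrA ler_pM2l// r1E -subr_ge0.
by rewrite (_ : _ - _ = (t * L ^+ 2 + d) ^+ 2) ?sqr_ge0//; ring.
Qed.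

Let th01 : 0 <= th <= 1.
Proof.
rewrite /th divr_ge0 ?(ltW s0)//= ler_pdivrMr// mul1r /s lerDl//.
Qed.

Lemma bipolar_sqr_longitudinal (th0 : R) : s <= 2 * L ->
  (t - th0) ^+ 2 <= 3 * (th - th0) ^+ 2 + 12 * (s - L) ^+ 2 / L ^+ 2 + 3 * q / L ^+ 2.
Proof.
have [hK hL] := (K1, L0); have [hr1 hr2] := (r10, r20).
move=> s2L; have Ls := bipolar_triangle.
have L2 : 0 < L ^+ 2 by rewrite exprn_gt0.
pose A := (s ^+ 2 / L ^+ 2 - 1) * (th - 1 / 2).
have -> : t - th0 = (th - th0) + A - d / L ^+ 2.
  by have := bipolar_longitudinal; rewrite -/A; lra.
have sq3 (x y z : R) : (x + y - z) ^+ 2 <= 3 * x ^+ 2 + 3 * y ^+ 2 + 3 * z ^+ 2.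
  rewrite -subr_ge0 (_ : _ - _ = (x - y) ^+ 2 + (x + z) ^+ 2 + (y + z) ^+ 2).
    by rewrite !addr_ge0 ?sqr_ge0.
  ring.
apply: (le_trans (sq3 _ _ _)).
(* Here (s + L) / L <= 3 and |th - 1/2| <= 1/2 give the factor 9/4, rounded up to 4. *)
have hA : A ^+ 2 <= 4 * ((s - L) ^+ 2 / L ^+ 2).
  have -> : A = (s - L) / L * ((s + L) / L * (th - 1 / 2)).
    by rewrite /A; field; rewrite gt_eqF.
  rewrite exprMn mulrC expr_div_n; apply: ler_wpM2r.
    by rewrite divr_ge0 ?sqr_ge0.
  have sL : 0 <= (s + L) / L <= 3.
    by rewrite divr_ge0 ?ler_pdivrMr//=; lra.
  have := th01; move: sL; set z := (s + L) / L => /andP[z0 z3] /andP[t0 t1].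
  have : `|z * (th - 1 / 2)| <= 3 * (1 / 2).
    rewrite normrM; apply: ler_pM => //; first by rewrite ger0_norm.
    by rewrite ler_norml; lra.
  move=> h; rewrite -real_normK ?num_real//.
  apply: (@le_trans _ _ ((3 * (1 / 2)) ^+ 2)); last by lra.
  by rewrite ler_sqr ?nnegrE//; lra.
have hd : (d / L ^+ 2) ^+ 2 <= q / L ^+ 2.
  rewrite expr_div_n ler_pdivrMr ?exprn_gt0//.
  apply: (le_trans bipolar_CS); rewrite le_eqVlt; apply/orP; left; apply/eqP.
  by field; rewrite gt_eqF.
have -> : 12 * (s - L) ^+ 2 / L ^+ 2 = 12 * ((s - L) ^+ 2 / L ^+ 2) by rewrite mulrA.
have -> : 3 * q / L ^+ 2 = 3 * (q / L ^+ 2) by rewrite mulrA.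
by lra.
Qed.

End bipolar.

(** * Pointwise upper bound *)

Section pointwise_upper.
Context {R : realType}.
Variables (g al be b K a a' : R) (M : nat).
Hypotheses (g01 : 0 < g < 1) (al0 : 0 < al) (be0 : 0 < be) (b0 : 0 < b)
  (K1 : 1 <= K).

Let S := al + be.
Let S0 : 0 < S. Proof. exact: addr_gt0. Qed.
Let ct := S `^ (1 - g).
Let ct0 : 0 < ct. Proof. exact: powR_gt0. Qed.
Let th0 := al / S.
Let th1 := be / S.
Let th00 : 0 < th0. Proof. exact: divr_gt0. Qed.
Let th10 : 0 < th1. Proof. exact: divr_gt0. Qed.
Let th01 : th0 + th1 = 1. Proof. by rewrite -mulrDl divff// gt_eqF. Qed.
Let kappa := ct * (g * (1 - g) / 4).
Let kappa0 : 0 < kappa.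
Proof. by have /andP[? ?] := g01; rewrite !mulr_gt0// subr_gt0. Qed.

(** What the exponent loses against its maximum: one term for the excess of the path 0, x, xi over
    L, one for an unbalanced ratio of its two legs. *)
Definition defect (L r1 r2 : R) :=
  b / 2 * (r1 + r2 - L) + kappa * (L `^ g * (r1 / (r1 + r2) - th0) ^+ 2).

(** Squared distance from x to th0 xi, with t measured in units of L^(-g/2) and w in units of
    L^(1/2), the scales of concentration. *)
Definition scaled_sqr (L t q : R) := L `^ g * (t - th0) ^+ 2 + q / L.

(** After the Hoelder defect, Bernoulli linearises s^g at L. For large L its slope, times ct, is at
    most b/2: half of b (s - L) pays for this growth and the other half stays in [defect]. *)
Lemma phase_le : exists2 L1, 1 <= L1 & forall L r1 r2 : R,
  L1 <= L -> 0 <= r1 -> 0 <= r2 -> L <= r1 + r2 ->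
  - b * (r1 + r2) + al `^ (1 - g) * r1 `^ g + be `^ (1 - g) * r2 `^ g <=
  - b * L + ct * L `^ g - defect L r1 r2.
Proof.
have /andP[g0 g1] := g01; have hb := b0; have hct := ct0.
(* The condition L^(1-g) >= x means ct L^(g-1) <= b/2. *)
pose x := 2 * ct / b.
have x0 : 0 < x by rewrite divr_gt0// mulr_gt0.
exists (1 + x `^ (1 - g)^-1); first by rewrite lerDl powR_ge0.
move=> L r1 r2 L1 r10 r20 Ls.
have h1 := powR_ge0 x (1 - g)^-1.
have L1' : 1 <= L by lra.
have L0 : 0 < L by lra.
have s0 : 0 < r1 + r2 by lra.
have xL : x <= L `^ (1 - g).
  have -> : x = (x `^ (1 - g)^-1) `^ (1 - g).
    by rewrite -powRrM mulVf ?powRr1// ?ltW// subr_eq0 gt_eqF.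
  by apply: ge0_ler_powR; rewrite ?nnegrE ?(ltW L0)//; lra.
have := hoelder_defect_le al0 be0 g01 r10 r20 s0.
set s := r1 + r2 in Ls s0 *; rewrite -/S -/ct -/th0; set e := _ ^+ 2 => Hd.
have e0 : 0 <= e by exact: sqr_ge0.
have sg : s `^ g <= L `^ g + L `^ g / L * (s - L).
  have -> : s `^ g = L `^ g * (s / L) `^ g.
    by rewrite -powRM ?divr_ge0 ?(ltW s0) ?(ltW L0)// mulrC divfK// gt_eqF.
  have := powR_Bernoulli g01 (divr_ge0 (ltW s0) (ltW L0)).
  have Lg : 0 <= L `^ g by exact: powR_ge0.
  move=> h; apply: (le_trans (ler_wpM2l Lg h)).
  have -> : L `^ g / L * (s - L) = L `^ g * (s / L - 1).
    by field; rewrite gt_eqF.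
  rewrite -[X in _ <= X + _]mulr1 -mulrDr; apply: ler_wpM2l => //.
  rewrite lerD2l ler_piMl ?(ltW g1)// subr_ge0 ler_pdivlMr// mul1r//.
have Lgs : L `^ g <= s `^ g.
  by apply: ge0_ler_powR; rewrite ?nnegrE ?(ltW s0) ?(ltW L0) ?(ltW g0).
have ctL : ct * (L `^ g / L) <= b / 2.
  have -> : L `^ g / L = (L `^ (1 - g))^-1.
    rewrite -powRN opprB powRB ?(gt_eqF L0) ?implybT// powRr1// ltW//.
  rewrite ler_pdivrMr ?powR_gt0//.
  have -> : ct = b / 2 * x by rewrite /x; field; rewrite gt_eqF.
  by rewrite ler_pM2l// divr_gt0.
apply: (@le_trans _ _ (- b * s + ct * s `^ g * (1 - g * (1 - g) / 4 * e))).
  by rewrite -addrA lerD2l.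
have k0 : 0 <= ct * (g * (1 - g) / 4) * e by rewrite mulr_ge0// ltW.
rewrite /defect -/s -/e /kappa.
have i1 : ct * s `^ g <= ct * (L `^ g + L `^ g / L * (s - L)) by rewrite ler_pM2l.
have i2 := ler_wpM2l k0 Lgs.
have i3 : ct * (L `^ g / L) * (s - L) <= b / 2 * (s - L).
  by apply: ler_wpM2r => //; lra.
have -> : ct * s `^ g * (1 - g * (1 - g) / 4 * e) =
   ct * s `^ g - ct * (g * (1 - g) / 4) * e * s `^ g by ring.
have -> : ct * (g * (1 - g) / 4) * (L `^ g * e) = ct * (g * (1 - g) / 4) * e * L `^ g.
  by ring.
have e1 : ct * (L `^ g + L `^ g / L * (s - L)) =
  ct * L `^ g + ct * (L `^ g / L) * (s - L) by ring.
move: i1 i2 i3; rewrite e1.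
lra.
Qed.

Section bounds.
Variables (L r1 r2 t d q : R).
Hypotheses (L1 : 1 <= L) (r10 : 0 <= r1) (r20 : 0 <= r2) (q0 : 0 <= q).
Hypothesis r1E : r1 ^+ 2 = t ^+ 2 * L ^+ 2 + 2 * t * d + q.
Hypothesis r2E : r2 ^+ 2 = (1 - t) ^+ 2 * L ^+ 2 - 2 * (1 - t) * d + q.
Hypothesis dq : K * d ^+ 2 <= (K - 1) * q * L ^+ 2.

Let s := r1 + r2.
Let L0 : 0 < L. Proof. exact: lt_le_trans L1. Qed.
Let Ls : L <= s. Proof. exact: (bipolar_triangle K1 L0 r10 r20 q0 r1E r2E dq). Qed.
Let s0 : 0 < s. Proof. exact: lt_le_trans Ls. Qed.
Let Lg1 : 1 <= L `^ g.
Proof. by have /andP[g0 _] := g01; rewrite -(powRr0 L) ler_powR// ltW. Qed.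
Let LgL : L `^ g <= L.
Proof.
by have /andP[_ g1] := g01; rewrite -[leRHS](powRr1 (ltW L0)) ler_powR// ltW.
Qed.

(** Since L^g <= L, the errors of [bipolar_sqr_longitudinal] become multiples of s - L and q / L,
    and q / L is itself at most 3K (s - L). *)
Lemma scaled_sqr_near : s <= 2 * L ->
  scaled_sqr L t q <= (3 / kappa + (24 + 24 * K) / b) * defect L r1 r2.
Proof.
move=> s2L; have hL := L0; have hs := Ls; have hk := kappa0; have hb := b0.
have hK := K1; have hq := q0; have hLg := Lg1.
have qs := bipolar_transversal K1 L0 r10 r20 q0 r1E r2E dq s2L.
have := bipolar_sqr_longitudinal K1 L0 r10 r20 q0 r1E r2E dq th0 s2L.
rewrite -/s; set e := (r1 / _ - th0) ^+ 2 => ht.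
have e0 : 0 <= e by exact: sqr_ge0.
have qL : q / L <= 3 * K * (s - L).
  by rewrite ler_pdivrMr//; move: qs; rewrite -/s mulrAC.
have i1 : L `^ g * (12 * (s - L) ^+ 2 / L ^+ 2) <= 12 * (s - L).
  apply: (@le_trans _ _ (L * (12 * (s - L) ^+ 2 / L ^+ 2))).
    apply: ler_wpM2r => //.
    by apply: divr_ge0; [apply: mulr_ge0 => //; exact: sqr_ge0|exact: sqr_ge0].
  have -> : L * (12 * (s - L) ^+ 2 / L ^+ 2) = 12 * (s - L) * ((s - L) / L).
    by field; rewrite gt_eqF.
  by rewrite ler_piMr ?mulr_ge0 ?subr_ge0// ler_pdivrMr// mul1r; lra.
have i2 : L `^ g * (3 * q / L ^+ 2) <= 3 * (q / L).
  apply: (@le_trans _ _ (L * (3 * q / L ^+ 2))).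
    apply: ler_wpM2r => //.
    by apply: divr_ge0; [exact: mulr_ge0|exact: sqr_ge0].
  rewrite le_eqVlt; apply/orP; left; apply/eqP.
  by field; rewrite gt_eqF.
have ht' := ler_wpM2l (powR_ge0 L g) ht.
rewrite /scaled_sqr; set A := _ + _ / b.
have -> : A * defect L r1 r2 =
  3 * (L `^ g * e) + (12 + 12 * K) * (s - L) +
  (24 + 24 * K) / b * (kappa * (L `^ g * e)) + 3 / kappa * (b / 2 * (s - L)).
  by rewrite /A /defect -/s -/e; field; rewrite !gt_eqF.
have i3 : 0 <= (24 + 24 * K) / b * (kappa * (L `^ g * e)).
  rewrite mulr_ge0//; first by rewrite divr_ge0//; lra.
  by rewrite mulr_ge0 ?(ltW hk)// mulr_ge0// powR_ge0.
have i4 : 0 <= 3 / kappa * (b / 2 * (s - L)).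
  by apply: mulr_ge0; [rewrite divr_ge0// ltW|apply: mulr_ge0; lra].
rewrite !mulrDr in ht'.
have -> : (12 + 12 * K) * (s - L) = 12 * (s - L) + 4 * (3 * K * (s - L)) by ring.
have e1 : L `^ g * (3 * e) = 3 * (L `^ g * e) by ring.
lra.
Qed.

(** A crude bound suffices far out, where the defect is linear in s. The degree 5 comes from t^2 of
    order s^4 times L^g <= s. *)
Lemma scaled_sqr_far : 1 + scaled_sqr L t q <= (7 + 7 * K) * (1 + s) ^+ 5.
Proof.
have hL := L0; have hs := Ls; have hK := K1; have hq := q0; have hL1 := L1.
have hr1 := r10; have hr2 := r20; have hth0 := th00; have hth1 := th10.
have hth := th01.
have K0 : 0 < K by lra.
have r1s : r1 <= s by rewrite /s; lra.
have r2s : r2 <= s by rewrite /s; lra.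
have sq x y : 0 <= x -> x <= y -> x ^+ 2 <= y ^+ 2 :> R.
  by move=> x0 xy; rewrite ler_sqr ?nnegrE//; exact: le_trans xy.
have r1s2 := sq _ _ r10 r1s; have r2s2 := sq _ _ r20 r2s.
have Ls2 := sq _ _ (ltW L0) hs.
have qs : q <= K * s ^+ 2.
  apply: (le_trans (bipolar_q_le K1 L0 r1E dq)).
  by rewrite ler_pM2l.
have s20 : 0 <= s ^+ 2 by exact: sqr_ge0.
have L20 : 0 <= L ^+ 2 by exact: sqr_ge0.
have ds : d ^+ 2 <= K * s ^+ 4.
  apply: (le_trans (bipolar_CS K1 q0 dq)).
  have -> : K * s ^+ 4 = K * s ^+ 2 * s ^+ 2 by ring.
  exact: ler_pM.
pose T := t * L ^+ 2.
have T2 : T ^+ 2 <= (2 + 3 * K) * s ^+ 4.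
  have TE : 2 * T = (r1 ^+ 2 - r2 ^+ 2) + L ^+ 2 - 2 * d.
    by rewrite /T r1E r2E; ring.
  have i1 : (r1 ^+ 2 - r2 ^+ 2) ^+ 2 <= s ^+ 4.
    have -> : s ^+ 4 = (s ^+ 2) ^+ 2 by ring.
    rewrite -[leLHS]real_normK ?num_real// ler_sqr ?nnegrE//.
    rewrite ler_norml; have := sqr_ge0 r1; have := sqr_ge0 r2; lra.
  have i2 : (L ^+ 2) ^+ 2 <= s ^+ 4.
    have -> : s ^+ 4 = (s ^+ 2) ^+ 2 by ring.
    exact: sq.
  have i3 : 4 * T ^+ 2 <=
      3 * (r1 ^+ 2 - r2 ^+ 2) ^+ 2 + 3 * (L ^+ 2) ^+ 2 + 12 * d ^+ 2.
    have -> : 4 * T ^+ 2 = (2 * T) ^+ 2 by ring.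
    rewrite TE; set x := _ - r2 ^+ 2; set y := L ^+ 2.
    rewrite -subr_ge0 (_ : _ - _ = (x - y) ^+ 2 + (x + 2 * d) ^+ 2 + (y + 2 * d) ^+ 2).
      by rewrite !addr_ge0 ?sqr_ge0.
    by ring.
  have s40 : 0 <= s ^+ 4 by rewrite exprn_ge0// ltW.
  lra.
have t2 : t ^+ 2 <= (2 + 3 * K) * s ^+ 4.
  apply: le_trans T2; rewrite /T exprMn ler_peMr ?sqr_ge0// -exprM.
  exact: exprn_ege1.
have tth : (t - th0) ^+ 2 <= 2 * t ^+ 2 + 2.
  rewrite -subr_ge0.
  have -> : 2 * t ^+ 2 + 2 - (t - th0) ^+ 2 = (t + th0) ^+ 2 + 2 * (1 - th0 ^+ 2).
    by ring.
  rewrite addr_ge0 ?sqr_ge0// mulr_ge0// subr_ge0 exprn_ile1//; lra.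
have ps n : (n <= 5)%N -> s ^+ n <= (1 + s) ^+ 5.
  move=> n5; apply: (@le_trans _ _ ((1 + s) ^+ n)).
    by rewrite lerXn2r ?nnegrE//; lra.
  by rewrite ler_weXn2l//; lra.
have p0 := ps 0 isT; have p1 := ps 1 isT; have p2 := ps 2 isT; have p5 := ps 5 isT.
rewrite expr0 in p0; rewrite expr1 in p1.
rewrite /scaled_sqr.
have j1 : L `^ g * (t - th0) ^+ 2 <= s * (2 * ((2 + 3 * K) * s ^+ 4) + 2).
  apply: ler_pM; rewrite ?powR_ge0 ?sqr_ge0//; first exact: le_trans LgL hs.
  lra.
have j2 : q / L <= K * s ^+ 2.
  apply: le_trans qs; rewrite ler_pdivrMr// ler_peMr//.
have j3 : s * (2 * ((2 + 3 * K) * s ^+ 4) + 2) = (4 + 6 * K) * s ^+ 5 + 2 * s by ring.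
have j4 : (4 + 6 * K) * s ^+ 5 <= (4 + 6 * K) * (1 + s) ^+ 5.
  by apply: ler_wpM2l => //; lra.
have j5 : K * s ^+ 2 <= K * (1 + s) ^+ 5 by apply: ler_wpM2l => //; lra.
set X := (1 + s) ^+ 5 in p0 p1 p2 p5 j4 j5 *.
have -> : (7 + 7 * K) * X = (4 + 6 * K) * X + K * X + 3 * X by ring.
lra.
Qed.

End bounds.

Lemma scaled_sqr_ge0 (L t q : R) : 0 < L -> 0 <= q -> 0 <= scaled_sqr L t q.
Proof.
move=> L0 q0; rewrite /scaled_sqr addr_ge0//; last by rewrite divr_ge0// ltW.
by apply: mulr_ge0; [exact: powR_ge0|exact: sqr_ge0].
Qed.

Lemma weights_le (L x1 x2 m : R) : 0 < L -> 0 < x1 -> 0 < x2 -> 1 <= m ->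
  L / m <= x1 <= m * L -> L / m <= x2 <= m * L ->
  x1 `^ a' * x2 `^ a <= m `^ (`|a| + `|a'|) * L `^ (a + a').
Proof.
move=> L0 x10 x20 m1 h1 h2; have m0 : 0 < m by exact: lt_le_trans m1.
rewrite !powRD ?(gt_eqF L0) ?(gt_eqF m0) ?implybT//.
have -> : m `^ `|a| * m `^ `|a'| * (L `^ a * L `^ a') =
  (m `^ `|a'| * L `^ a') * (m `^ `|a| * L `^ a) by ring.
by apply: ler_pM; rewrite ?powR_ge0//; exact: powR_comparable.
Qed.

Lemma defect_ge_excess (L r1 r2 : R) : b / 2 * (r1 + r2 - L) <= defect L r1 r2.
Proof.
rewrite lerDl; apply: mulr_ge0; first exact: ltW.
by apply: mulr_ge0; [exact: powR_ge0|exact: sqr_ge0].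
Qed.

Lemma defect_ge_angle (L r1 r2 : R) : L <= r1 + r2 ->
  kappa * (L `^ g * (r1 / (r1 + r2) - th0) ^+ 2) <= defect L r1 r2.
Proof.
move=> Ls; rewrite lerDr; apply: mulr_ge0; last by rewrite subr_ge0.
by rewrite divr_ge0// ltW.
Qed.

(** Each weight base is within a factor 1 + s of L. For s >= 2L, half of the defect is at least b s
    / 8, whose exponential absorbs the resulting power of 1 + s. *)
Let weights_far : exists2 C, 0 < C & forall L r1 r2 : R,
  1 <= L -> 0 <= r1 -> 0 <= r2 -> 2 * L <= r1 + r2 ->
  (1 + r1) `^ a' * (1 + r2) `^ a <=
  C * expR (defect L r1 r2 / 2) * L `^ (a + a').
Proof.
have b8 : 0 < b / 8 by exact: divr_gt0.
have [C C0 HC] := powR_le_expR (addr_ge0 (normr_ge0 a) (normr_ge0 a')) b8.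
exists C => // L r1 r2 L1 r10 r20 s2L.
have h r : 0 <= r -> r <= r1 + r2 ->
    L / (1 + (r1 + r2)) <= 1 + r <= (1 + (r1 + r2)) * L.
  move=> r0 rs; apply/andP; split.
    rewrite ler_pdivrMr; last by lra.
    have : 0 <= r * (1 + (r1 + r2)) by rewrite mulr_ge0//; lra.
    by lra.
  by apply: (@le_trans _ _ (1 + (r1 + r2))); [lra|rewrite ler_peMr//; lra].
have w : (1 + r1) `^ a' * (1 + r2) `^ a <=
    (1 + (r1 + r2)) `^ (`|a| + `|a'|) * L `^ (a + a').
  by apply: weights_le; [lra|lra|lra|lra|apply: h; lra|apply: h; lra].
apply: (le_trans w); apply: ler_wpM2r; first exact: powR_ge0.
apply: (le_trans (HC _ (addr_ge0 r10 r20))); rewrite ler_pM2l// ler_expR.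
have D := defect_ge_excess L r1 r2.
have : b / 4 * (r1 + r2) <= b / 2 * (r1 + r2 - L).
  have -> : b / 2 * (r1 + r2 - L) = b / 4 * (2 * (r1 + r2 - L)) by field.
  by rewrite ler_pM2l ?divr_gt0//; lra.
by lra.
Qed.

(** As th0 + th1 = 1, this is below both th0 / 2 and th1 / 2: if r1 / s is within [delta] of th0,
    both focal distances are of order L. *)
Let delta := th0 * th1 / 2.
Let delta0 : 0 < delta. Proof. by rewrite divr_gt0// mulr_gt0. Qed.
Let delta_le0 : delta <= th0 / 2.
Proof. by rewrite ler_pM2r// ler_piMr ?(ltW th00)// -th01 lerDr ltW. Qed.
Let delta_le1 : delta <= th1 / 2.
Proof. by rewrite ler_pM2r// ler_piMl ?(ltW th10)// -th01 lerDl ltW. Qed.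

Let focal_ratio_ge (th L r s : R) : 0 < th -> delta <= th / 2 ->
  0 < L -> L <= s -> - delta <= r / s - th -> L * (th / 2) <= r.
Proof.
move=> t0 dt L0 Ls h; have s0 : 0 < s by exact: lt_le_trans Ls.
have : th / 2 <= r / s by lra.
rewrite ler_pdivlMr//; apply: le_trans.
by rewrite mulrC ler_pM2l// divr_gt0.
Qed.

Let weights_center : exists2 C, 0 < C & forall L r1 r2 : R,
  1 <= L -> 0 <= r1 -> 0 <= r2 -> L <= r1 + r2 -> r1 + r2 <= 2 * L ->
  `|r1 / (r1 + r2) - th0| <= delta ->
  (1 + r1) `^ a' * (1 + r2) `^ a <=
  C * expR (defect L r1 r2 / 2) * L `^ (a + a').
Proof.
pose m := 3 + 2 / th0 + 2 / th1.
have q0 : 0 < 2 / th0 by exact: divr_gt0.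
have q1 : 0 < 2 / th1 by exact: divr_gt0.
have m1 : 1 <= m by rewrite /m; lra.
have m0 : 0 < m by exact: lt_le_trans m1.
exists (m `^ (`|a| + `|a'|)); first exact: powR_gt0.
move=> L r1 r2 L1 r10 r20 Ls s2L; rewrite ler_norml => /andP[h1 h2].
have L0 : 0 < L by exact: lt_le_trans L1.
have h r th : 0 < th -> 2 / th <= m -> L * (th / 2) <= r -> r <= r1 + r2 ->
    L / m <= 1 + r <= m * L.
  move=> t0 thm rl rs; apply/andP; split.
    apply: (@le_trans _ _ (L * (th / 2))); last by lra.
    by rewrite ler_pM2l// -invf_div lef_pV2 ?posrE ?divr_gt0.
  apply: (@le_trans _ _ (3 * L)); first by lra.
  by rewrite ler_pM2r// /m; lra.
have w : (1 + r1) `^ a' * (1 + r2) `^ a <=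
    m `^ (`|a| + `|a'|) * L `^ (a + a').
  apply: weights_le; [by []|lra|lra|by []| |].
  - apply: (h _ th0) => //; [by rewrite /m; lra| |by lra].
    exact: focal_ratio_ge delta_le0 L0 Ls h1.
  - apply: (h _ th1) => //; [by rewrite /m; lra| |by lra].
    apply: (focal_ratio_ge th10 delta_le1 L0 Ls).
    have -> : r2 / (r1 + r2) - th1 = - (r1 / (r1 + r2) - th0).
      have -> : r2 / (r1 + r2) = 1 - r1 / (r1 + r2).
        by field; rewrite gt_eqF// (lt_le_trans L0).
      by rewrite -th01; ring.
    by rewrite lerN2.
apply: (le_trans w); apply: ler_wpM2r; first exact: powR_ge0.
rewrite ler_peMr ?powR_ge0// -[leLHS]expR0 ler_expR divr_ge0//.
apply: le_trans (defect_ge_excess _ _ _).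
by rewrite mulr_ge0 ?subr_ge0// divr_ge0// ltW.
Qed.

(** Near a focus the weights may be off by a power L^k, but the defect is then at least kappa
    delta^2 L^g, and an exponential of L^g beats L^k = (L^g)^(k/g). *)
Let weights_side : exists2 C, 0 < C & forall L r1 r2 : R,
  1 <= L -> 0 <= r1 -> 0 <= r2 -> L <= r1 + r2 -> r1 + r2 <= 2 * L ->
  delta < `|r1 / (r1 + r2) - th0| ->
  (1 + r1) `^ a' * (1 + r2) `^ a <=
  C * expR (defect L r1 r2 / 2) * L `^ (a + a').
Proof.
have /andP[g0 g1] := g01; set k := `|a| + `|a'|.
have k0 : 0 <= k by rewrite addr_ge0.
have kd0 : 0 < kappa * delta ^+ 2 / 2.
  by apply: divr_gt0 => //; apply: mulr_gt0 => //; exact: exprn_gt0.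
have [C C0 HC] := powR_le_expR (divr_ge0 k0 (ltW g0)) kd0.
exists (3 `^ k * C); first by rewrite mulr_gt0// powR_gt0.
move=> L r1 r2 L1 r10 r20 Ls s2L hd.
have L0 : 0 < L by exact: lt_le_trans L1.
have h r : 0 <= r -> r <= r1 + r2 -> L / (3 * L) <= 1 + r <= (3 * L) * L.
  move=> r0 rs; apply/andP; split.
    have -> : L / (3 * L) = 1 / 3 by field; rewrite gt_eqF.
    by lra.
  by apply: (@le_trans _ _ (3 * L)); [lra|rewrite ler_peMr//; lra].
have w : (1 + r1) `^ a' * (1 + r2) `^ a <= (3 * L) `^ k * L `^ (a + a').
  by apply: weights_le; [by []|lra|lra|lra|apply: h; lra|apply: h; lra].
apply: (le_trans w); apply: ler_wpM2r; first exact: powR_ge0.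
have -> : (3 * L) `^ k = 3 `^ k * (L `^ g) `^ (k / g).
  rewrite powRM ?(ltW L0)// -powRrM; congr (_ * _ `^ _).
  by rewrite mulrC divfK// gt_eqF.
rewrite -mulrA ler_pM2l ?powR_gt0//.
have Lg0 := powR_ge0 L g.
apply: (@le_trans _ _ ((1 + L `^ g) `^ (k / g))).
  apply: ge0_ler_powR; first by rewrite divr_ge0// ltW.
  - by rewrite nnegrE.
  - by rewrite nnegrE addr_ge0.
  - by rewrite lerDr.
apply: (le_trans (HC _ Lg0)); rewrite ler_pM2l// ler_expR.
rewrite mulrAC ler_pM2r ?invr_gt0//; apply: le_trans (defect_ge_angle Ls).
rewrite -mulrA ler_pM2l// [leLHS]mulrC ler_wpM2l//.
rewrite -[leRHS]real_normK ?num_real// ler_sqr ?nnegrE ?(ltW delta0)//.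
exact: ltW.
Qed.

Lemma weights_le_expR : exists2 C, 0 < C & forall L r1 r2 : R,
  1 <= L -> 0 <= r1 -> 0 <= r2 -> L <= r1 + r2 ->
  (1 + r1) `^ a' * (1 + r2) `^ a <=
  C * expR (defect L r1 r2 / 2) * L `^ (a + a').
Proof.
have [C1 C10 H1] := weights_far; have [C2 C20 H2] := weights_center.
have [C3 C30 H3] := weights_side.
exists (C1 + C2 + C3); first by rewrite !addr_gt0.
move=> L r1 r2 L1 r10 r20 Ls.
have weaken C : C <= C1 + C2 + C3 -> C * expR (defect L r1 r2 / 2) * L `^ (a + a') <=
    (C1 + C2 + C3) * expR (defect L r1 r2 / 2) * L `^ (a + a').
  by move=> hC; rewrite ler_wpM2r ?powR_ge0// ler_wpM2r ?expR_ge0.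
have [s2L|/ltW s2L] := leP (r1 + r2) (2 * L); last first.
  by apply: le_trans (H1 _ _ _ L1 r10 r20 s2L) (weaken _ _); lra.
have [hd|hd] := leP `|r1 / (r1 + r2) - th0| delta.
  by apply: le_trans (H2 _ _ _ L1 r10 r20 Ls s2L hd) (weaken _ _); lra.
by apply: le_trans (H3 _ _ _ L1 r10 r20 Ls s2L hd) (weaken _ _); lra.
Qed.

(** One half of the defect pays for the weights; this spends the other half on polynomial decay. The
    power [M] will be the dimension, giving one integrable factor per coordinate. *)
Lemma scaled_sqr_le_expR : exists2 C, 0 < C & forall L r1 r2 t d q : R,
  1 <= L -> bipolar K L r1 r2 t d q ->
  (1 + scaled_sqr L t q) ^+ M <= C * expR (defect L r1 r2 / 2).
Proof.
have hb := b0; have hk := kappa0; have hK := K1.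
pose A := 3 / kappa + (24 + 24 * K) / b.
have A0 : 0 < A by rewrite addr_gt0 ?divr_gt0//; lra.
(* With this rate, [scaled_sqr] <= A [defect] yields the exponent [defect] / 2. *)
have A2 : 0 < (2 * A)^-1 by rewrite invr_gt0 mulr_gt0.
have b8 : 0 < b / 8 by exact: divr_gt0.
have [C1 C10 HC1] := powR_le_expR (ler0n R M) A2.
have [C2 C20 HC2] := powR_le_expR (ler0n R (5 * M)%N) b8.
pose C3 := (7 + 7 * K) ^+ M * C2.
have C30 : 0 < C3 by rewrite mulr_gt0// exprn_gt0//; lra.
exists (C1 + C3); first by rewrite addr_gt0.
move=> L r1 r2 t d q L1 [r10 r20 q0 r1E r2E dq].
have L0 : 0 < L by lra.
have Ls := bipolar_triangle K1 L0 r10 r20 q0 r1E r2E dq.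
have Q0 := scaled_sqr_ge0 t L0 q0.
have wk C : C <= C1 + C3 -> forall X, X <= C * expR (defect L r1 r2 / 2) ->
    X <= (C1 + C3) * expR (defect L r1 r2 / 2).
  by move=> hC X /le_trans; apply; rewrite ler_pM2r ?expR_gt0.
have [s2L|s2L] := leP (r1 + r2) (2 * L).
  apply: (@wk C1); first by lra.
  rewrite -powR_mulrn; last by lra.
  apply: (le_trans (HC1 _ Q0)); rewrite ler_pM2l// ler_expR.
  have := scaled_sqr_near L1 r10 r20 q0 r1E r2E dq s2L.
  rewrite -/A -(ler_pM2l A2) => /le_trans; apply.
  rewrite le_eqVlt; apply/orP; left; apply/eqP.
  by field; rewrite gt_eqF.
apply: (@wk C3); first by lra.
have s0 : 0 <= r1 + r2 by lra.
apply: (@le_trans _ _ (((7 + 7 * K) * (1 + (r1 + r2)) ^+ 5) ^+ M)).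
  have h := scaled_sqr_far L1 r10 r20 q0 r1E r2E dq.
  have h0 : 0 <= 1 + scaled_sqr L t q by rewrite addr_ge0.
  by rewrite lerXn2r ?nnegrE// (le_trans h0).
rewrite exprMn -exprM /C3 -mulrA ler_pM2l; last by rewrite exprn_gt0//; lra.
rewrite -powR_mulrn; last by lra.
apply: (le_trans (HC2 _ s0)); rewrite ler_pM2l// ler_expR /defect.
have : 0 <= kappa * (L `^ g * (r1 / (r1 + r2) - th0) ^+ 2).
  by rewrite mulr_ge0 ?(ltW hk)// mulr_ge0 ?powR_ge0 ?sqr_ge0.
have : b / 8 * (r1 + r2) <= b / 4 * (r1 + r2 - L).
  have -> : b / 4 * (r1 + r2 - L) = b / 8 * (2 * (r1 + r2 - L)) by field.
  by rewrite ler_pM2l//; lra.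
lra.
Qed.

(** The product of [weights_le_expR], [phase_le] and [scaled_sqr_le_expR]; the exponentials of the
    defect cancel. The shift 1 + r keeps negative powers bounded near the foci. *)
Lemma pointwise_upper : exists C L1, [/\ 0 < C, 1 <= L1 &
  forall L r1 r2 t d q : R, L1 <= L -> bipolar K L r1 r2 t d q ->
  (1 + r1) `^ a' * (1 + r2) `^ a *
    expR (- b * (r1 + r2) + al `^ (1 - g) * r1 `^ g + be `^ (1 - g) * r2 `^ g) <=
  C * (L `^ (a + a') * expR (- b * L + ct * L `^ g)) /
    (1 + scaled_sqr L t q) ^+ M].
Proof.
have [C1 C10 H1] := weights_le_expR.
have [C2 C20 H2] := scaled_sqr_le_expR.
have [L1 L11 H3] := phase_le.
exists (C1 * C2), L1; split=> //; first exact: mulr_gt0.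
move=> L r1 r2 t d q L1L B; have [r10 r20 q0 r1E r2E dq] := B.
have L1' : 1 <= L by exact: le_trans L1L.
have L0 : 0 < L by exact: lt_le_trans L1'.
have Ls := bipolar_triangle K1 L0 r10 r20 q0 r1E r2E dq.
have Q0 := scaled_sqr_ge0 t L0 q0.
have QM : 0 < (1 + scaled_sqr L t q) ^+ M by rewrite exprn_gt0// ltr_wpDr.
rewrite ler_pdivlMr//.
have h1 := H1 _ _ _ L1' r10 r20 Ls.
have h2 := H2 _ _ _ _ _ _ L1' B.
have := H3 _ _ _ L1L r10 r20 Ls; rewrite -ler_expR => h3.
have w0 : 0 <= (1 + r1) `^ a' * (1 + r2) `^ a by rewrite mulr_ge0 ?powR_ge0.
have := ler_pM (mulr_ge0 w0 (expR_ge0 _)) (ltW QM) (ler_pM w0 (expR_ge0 _) h1 h3) h2.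
move=> /le_trans; apply; rewrite le_eqVlt; apply/orP; left; apply/eqP.
set D := defect _ _ _.
have -> : expR (- b * L + ct * L `^ g - D) =
  expR (- b * L + ct * L `^ g) / (expR (D / 2) * expR (D / 2)).
  by rewrite -expRD -expRN -expRD; congr expR; field.
by field; rewrite gt_eqF// expR_gt0.
Qed.

End pointwise_upper.

(** * Pointwise lower bound *)

Section pointwise_lower.
Context {R : realType}.
Variables (g al be b K a a' : R).
Hypotheses (g01 : 0 < g < 1) (al0 : 0 < al) (be0 : 0 < be) (b0 : 0 < b)
  (K1 : 1 <= K).

Let S := al + be.
Let S0 : 0 < S. Proof. exact: addr_gt0. Qed.
Let ct := S `^ (1 - g).
Let ct0 : 0 < ct. Proof. exact: powR_gt0. Qed.
Let th0 := al / S.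
Let th1 := be / S.
Let th00 : 0 < th0. Proof. exact: divr_gt0. Qed.
Let th10 : 0 < th1. Proof. exact: divr_gt0. Qed.
Let th01 : th0 + th1 = 1. Proof. by rewrite -mulrDl divff// gt_eqF. Qed.

Lemma powR_eventually_le (e c : R) : 0 < e ->
  exists2 L0, 1 <= L0 & forall L, L0 <= L -> c <= L `^ e.
Proof.
move=> e0; exists (1 + (1 + `|c|) `^ e^-1); first by rewrite lerDl powR_ge0.
move=> L hL; have c1 : 0 <= 1 + `|c| by rewrite addr_ge0.
have hc := powR_ge0 (1 + `|c|) e^-1.
apply: (@le_trans _ _ (1 + `|c|)); first by rewrite (le_trans (ler_norm c))// lerDr.
have -> : 1 + `|c| = ((1 + `|c|) `^ e^-1) `^ e.
  by rewrite -powRrM mulVf ?powRr1// gt_eqF.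
apply: ge0_ler_powR; rewrite ?nnegrE ?(ltW e0)//; lra.
Qed.

(** A is the length of the orthogonal projection on R xi, so r^2 <= A^2 + q <= (A + q / (2A))^2. The
    second focus is the case tt = 1 - t with -d for d. *)
Lemma focal_distance_le (A L r tt d q : R) : 0 < A -> 0 < L -> 0 <= r -> 0 <= q ->
  A = tt * L + d / L -> r ^+ 2 = tt ^+ 2 * L ^+ 2 + 2 * tt * d + q ->
  r <= A + q / (2 * A).
Proof.
move=> A0 L0 r0 q0 AE rE.
have q2 : 0 <= q / (2 * A) by rewrite divr_ge0// mulr_ge0// ltW.
rewrite -ler_sqr ?nnegrE ?addr_ge0// ?(ltW A0)// rE -subr_ge0.
have -> : (A + q / (2 * A)) ^+ 2 - (tt ^+ 2 * L ^+ 2 + 2 * tt * d + q) =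
    (d / L) ^+ 2 + (q / (2 * A)) ^+ 2 + (A ^+ 2 - (tt * L + d / L) ^+ 2).
  by field; rewrite !gt_eqF.
by rewrite -AE subrr addr0 addr_ge0// sqr_ge0.
Qed.

Lemma focal_distance_ge (A L r tt d q : R) : 0 < L -> 0 <= A -> 0 <= r ->
  d ^+ 2 <= q * L ^+ 2 ->
  A = tt * L + d / L -> r ^+ 2 = tt ^+ 2 * L ^+ 2 + 2 * tt * d + q ->
  A <= r.
Proof.
move=> L0 A0 r0 dq AE rE.
rewrite -ler_sqr ?nnegrE// rE -subr_ge0.
have -> : tt ^+ 2 * L ^+ 2 + 2 * tt * d + q - A ^+ 2 =
    (q * L ^+ 2 - d ^+ 2) / L ^+ 2.
  by rewrite AE; field; rewrite gt_eqF.
by rewrite divr_ge0 ?sqr_ge0// subr_ge0.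
Qed.

(** Below th0 / 4 and th1 / 4, so an offset of at most 2 tau keeps both projections longer than tau
    L. *)
Let tau := th0 * th1 / 4.
Let tau0 : 0 < tau. Proof. by rewrite divr_gt0// mulr_gt0. Qed.
Let tau_th0 : tau <= th0 / 4.
Proof.
have := th01; have := th00; have := th10 => h1 h0 h.
by rewrite /tau ler_pM2r// ler_piMr//; lra.
Qed.
Let tau_th1 : tau <= th1 / 4.
Proof.
have := th01; have := th00; have := th10 => h1 h0 h.
by rewrite /tau ler_pM2r// ler_piMl//; lra.
Qed.

(** The projections add up to L, and each correction q / (2A) is at most K / (2 tau) because q <= K
    L and A >= tau L. *)
Let excess (L r1 r2 q A A' : R) : 1 <= L ->
  tau * L <= A -> tau * L <= A' -> A + A' = L -> q <= K * L ->
  r1 <= A + q / (2 * A) -> r2 <= A' + q / (2 * A') ->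
  r1 + r2 <= L + K / tau.
Proof.
move=> L1 hA hA' AA qK h1 h2; have ht := tau0; have hK := K1.
have tL : 0 < tau * L by rewrite mulr_gt0//; lra.
have qA (X : R) : tau * L <= X -> q / (2 * X) <= K / tau / 2.
  move=> hX; have X0 : 0 < X by lra.
  rewrite ler_pdivrMr ?mulr_gt0//; apply: (le_trans qK).
  have -> : K / tau / 2 * (2 * X) = K / tau * X by field; rewrite gt_eqF.
  apply: (@le_trans _ _ (K / tau * (tau * L))).
    by rewrite le_eqVlt; apply/orP; left; apply/eqP; field; rewrite gt_eqF.
  by rewrite ler_pM2l// divr_gt0//; lra.
have := qA _ hA; have := qA _ hA'; lra.
Qed.

Let sqr_le_itv (x y : R) : 0 < y -> x ^+ 2 <= y ^+ 2 -> - y <= x <= y.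
Proof.
move=> y0 hx; rewrite -ler_norml -ler_sqr ?nnegrE ?(ltW y0)//.
by rewrite real_normK ?num_real.
Qed.

Section box_estimates.
Variables (L t d q : R).
Hypotheses (L1 : 1 <= L) (dq : d ^+ 2 <= q * L ^+ 2).
Hypotheses (tL : (t - th0) ^+ 2 * L `^ g <= 1) (qL : q <= K * L).

Let L0 : 0 < L. Proof. exact: lt_le_trans L1. Qed.

(** The orthogonal projection of x on R xi is (th0 + e) xi, whereas t is its oblique coordinate. *)
Let e := t + d / L ^+ 2 - th0.

Let sqr_dL : (d / L ^+ 2) ^+ 2 <= K / L.
Proof.
rewrite expr_div_n ler_pdivrMr ?exprn_gt0//; apply: (le_trans dq).
have -> : K / L * (L ^+ 2) ^+ 2 = K * L * L ^+ 2 by field; rewrite gt_eqF.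
by rewrite ler_pM2r ?exprn_gt0.
Qed.

Lemma box_offset_le : tau ^- 2 <= L `^ g -> K / tau ^+ 2 <= L ->
  - (2 * tau) <= e <= 2 * tau.
Proof.
move=> hg hk; have t2 : 0 < tau ^+ 2 by rewrite exprn_gt0.
have /(sqr_le_itv tau0) ht : (t - th0) ^+ 2 <= tau ^+ 2.
  have Lg0 : 0 < L `^ g by exact: powR_gt0.
  apply: (@le_trans _ _ (L `^ g)^-1); first by rewrite -[leRHS]mul1r ler_pdivlMr.
  by rewrite -[leRHS]invrK lef_pV2 ?posrE ?invr_gt0.
have /(sqr_le_itv tau0) hd : (d / L ^+ 2) ^+ 2 <= tau ^+ 2.
  apply: (le_trans sqr_dL); rewrite ler_pdivrMr// mulrC -ler_pdivrMr//.
by rewrite /e; lra.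
Qed.

Lemma box_offset_sqr : L `^ g * e ^+ 2 <= 2 + 2 * K.
Proof.
have /andP[g0 g1] := g01.
have Lg0 : 0 <= L `^ g by exact: powR_ge0.
have LgL : L `^ g <= L.
  by rewrite -[leRHS](powRr1 (ltW L0)) ler_powR// ltW.
have h : e ^+ 2 <= 2 * (t - th0) ^+ 2 + 2 * (d / L ^+ 2) ^+ 2.
  rewrite -subr_ge0 (_ : _ - _ = (t - th0 - d / L ^+ 2) ^+ 2) ?sqr_ge0//.
  by rewrite /e; ring.
apply: (le_trans (ler_wpM2l Lg0 h)).
have hd : L `^ g * (d / L ^+ 2) ^+ 2 <= K.
  apply: (@le_trans _ _ (L * (K / L))).
    by apply: ler_pM => //; exact: sqr_ge0.
  by rewrite mulrC divfK// gt_eqF.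
have -> : L `^ g * (2 * (t - th0) ^+ 2 + 2 * (d / L ^+ 2) ^+ 2) =
  2 * ((t - th0) ^+ 2 * L `^ g) + 2 * (L `^ g * (d / L ^+ 2) ^+ 2) by ring.
by move: tL hd; lra.
Qed.

End box_estimates.

Let Cd := 2 * (S / al + S / be).
Let Cd0 : 0 < Cd. Proof. by rewrite mulr_gt0// addr_gt0// divr_gt0. Qed.

(** In the power terms r1 and r2 are lowered to their projections, whose sum is exactly L, so that
    [hoelder_defect_ge] applies with e as the deviation of the ratio. *)
Lemma phase_ge (L e r1 r2 m1 m2 : R) : 0 < L -> - (2 * tau) <= e <= 2 * tau ->
  L * (th0 + e) <= r1 -> L * (th1 - e) <= r2 ->
  r1 + r2 <= L + m1 -> L `^ g * e ^+ 2 <= m2 ->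
  - b * L + ct * L `^ g - (b * m1 + ct * (Cd * m2)) <=
  - b * (r1 + r2) + al `^ (1 - g) * r1 `^ g + be `^ (1 - g) * r2 `^ g.
Proof.
have /andP[g0 g1] := g01; have ht0 := tau_th0; have ht1 := tau_th1.
have h00 := th00; have h10 := th10.
move=> L0 /andP[e1 e2] hr1 hr2 exc he.
have k1 : th0 / 2 <= th0 + e by lra.
have k2 : th1 / 2 <= th1 - e by lra.
have A0 : 0 <= L * (th0 + e) by apply: mulr_ge0; lra.
have B0 : 0 <= L * (th1 - e) by apply: mulr_ge0; lra.
have AB : L * (th0 + e) + L * (th1 - e) = L.
  by rewrite -mulrDr addrACA subrr addr0 th01 mulr1.
have := hoelder_defect_ge al0 be0 g01 A0 B0.
rewrite AB ![L * _]mulrC !mulfK ?gt_eqF// => /(_ L0 k1 k2).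
rewrite -/S -/th0 -/ct -/Cd (_ : th0 + e - th0 = e); last by ring.
rewrite ![_ * L]mulrC => hd.
have g1a : al `^ (1 - g) * (L * (th0 + e)) `^ g <= al `^ (1 - g) * r1 `^ g.
  rewrite ler_wpM2l ?powR_ge0//; apply: ge0_ler_powR => //; rewrite ?nnegrE ?(ltW g0)//.
  exact: le_trans hr1.
have g2a : be `^ (1 - g) * (L * (th1 - e)) `^ g <= be `^ (1 - g) * r2 `^ g.
  rewrite ler_wpM2l ?powR_ge0//; apply: ge0_ler_powR => //; rewrite ?nnegrE ?(ltW g0)//.
  exact: le_trans hr2.
have j : ct * (Cd * (L `^ g * e ^+ 2)) <= ct * (Cd * m2).
  by rewrite ler_pM2l// ler_pM2l.
have jb : b * (r1 + r2) <= b * (L + m1) by rewrite ler_pM2l.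
have ctE : ct * L `^ g * (1 - Cd * e ^+ 2) =
    ct * L `^ g - ct * (Cd * (L `^ g * e ^+ 2)) by ring.
move: g1a g2a hd j jb; rewrite ctE mulrDr !mulNr; lra.
Qed.

Lemma weights_ge (L r1 r2 m : R) : 0 < L -> 0 < r1 -> 0 < r2 -> 1 <= m ->
  r1 / m <= L <= m * r1 -> r2 / m <= L <= m * r2 ->
  (m `^ `|a'| * m `^ `|a|)^-1 * L `^ (a + a') <= r1 `^ a' * r2 `^ a.
Proof.
move=> L0 r10 r20 m1 c1 c2; have m0 : 0 < m by exact: lt_le_trans m1.
have mm : 0 < m `^ `|a'| * m `^ `|a| by rewrite mulr_gt0// powR_gt0.
rewrite -ler_pdivlMl ?invr_gt0// invrK powRD ?(gt_eqF L0) ?implybT//.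
have -> : m `^ `|a'| * m `^ `|a| * (r1 `^ a' * r2 `^ a) =
  (m `^ `|a| * r2 `^ a) * (m `^ `|a'| * r1 `^ a') by ring.
by apply: ler_pM; rewrite ?powR_ge0//; exact: powR_comparable.
Qed.

Lemma focal_comparable (L r : R) : 1 <= L -> tau * L <= r -> r <= L + K / tau ->
  r / (1 + K / tau + tau^-1) <= L <= (1 + K / tau + tau^-1) * r.
Proof.
move=> L1 rl ru; have L0 : 0 < L by exact: lt_le_trans L1.
have K0 : 0 < K by exact: lt_le_trans K1.
have Kt0 : 0 < K / tau by exact: divr_gt0.
have it0 : 0 < tau^-1 by rewrite invr_gt0.
have r0 : 0 < r by apply: lt_le_trans rl; exact: mulr_gt0.
apply/andP; split.
  rewrite ler_pdivrMr ?addr_gt0//; apply: (le_trans ru).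
  rewrite !mulrDr mulr1 -addrA lerD2l ler_wpDr//; first by rewrite ltW// mulr_gt0.
  by rewrite ler_peMl// ltW.
apply: (@le_trans _ _ (tau^-1 * r)); first by rewrite -ler_pdivrMl ?invr_gt0// invrK.
by rewrite ler_pM2r// lerDr addr_ge0// ltW.
Qed.

(* On the box |t - th0| <= L ^ (- g / 2), |w| ^ 2 <= K L the exponent loses only
   a constant. *)
Lemma pointwise_lower : exists c L1 k, [/\ 0 < c, 1 <= L1, 0 < k &
  forall L r1 r2 t d q : R, L1 <= L -> bipolar K L r1 r2 t d q ->
  (t - th0) ^+ 2 * L `^ g <= 1 -> q <= K * L ->
  [/\ k * L <= r1, k * L <= r2 &
  c * (L `^ (a + a') * expR (- b * L + ct * L `^ g)) <=
  r1 `^ a' * r2 `^ a *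
    expR (- b * (r1 + r2) + al `^ (1 - g) * r1 `^ g + be `^ (1 - g) * r2 `^ g)]].
Proof.
have /andP[g0 g1] := g01; have K0 : 0 < K by exact: lt_le_trans K1.
have [L1 L11 H1] := powR_eventually_le (tau ^- 2) g0.
have [L2 L21 H2] := @powR_eventually_le 1 (K / tau ^+ 2) ltr01.
pose m := 1 + K / tau + tau^-1.
have m1 : 1 <= m.
  rewrite /m -addrA lerDl; apply: ltW.
  by apply: addr_gt0; [exact: divr_gt0|rewrite invr_gt0].
have m0 : 0 < m by exact: lt_le_trans m1.
pose D := b * (K / tau) + ct * (Cd * (2 + 2 * K)).
exists ((m `^ `|a'| * m `^ `|a|)^-1 * expR (- D)), (L1 + L2), tau; split=> //.
- by rewrite mulr_gt0 ?expR_gt0// invr_gt0 mulr_gt0// powR_gt0.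
- by rewrite (le_trans L11)// lerDl (le_trans ler01).
move=> L r1 r2 t d q hL [r10 r20 q0 r1E r2E dq] tL qL.
have L1L : L1 <= L by rewrite (le_trans _ hL)// lerDl (le_trans ler01).
have L2L : L2 <= L by rewrite (le_trans _ hL)// lerDr (le_trans ler01).
have L1' : 1 <= L by exact: le_trans L1L.
have L0 : 0 < L by exact: lt_le_trans L1'.
have CS := bipolar_CS K1 q0 dq.
have hk : K / tau ^+ 2 <= L by rewrite -[leRHS](powRr1 (ltW L0)) H2.
have eb := box_offset_le L1' CS tL qL (H1 _ L1L) hk.
have es := box_offset_sqr L1' CS tL qL.
set e := _ - th0 in eb es.
pose A := L * (th0 + e); pose A' := L * (th1 - e).
have AE : A = t * L + d / L by rewrite /A /e; field; rewrite gt_eqF.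
have A'E : A' = (1 - t) * L + (- d) / L.
  by rewrite /A' /e -th01; field; rewrite gt_eqF.
have AA : A + A' = L by rewrite AE A'E; ring.
have tL0 : 0 < tau * L by exact: mulr_gt0.
have [eA eA'] : tau * L <= A /\ tau * L <= A'.
  rewrite ![tau * L]mulrC !ler_pM2l//; have := tau_th0; have := tau_th1.
  by move: eb tau0; split; lra.
have A0 : 0 < A by exact: lt_le_trans eA.
have A'0 : 0 < A' by exact: lt_le_trans eA'.
have r2E' : r2 ^+ 2 = (1 - t) ^+ 2 * L ^+ 2 + 2 * (1 - t) * (- d) + q.
  by rewrite r2E; ring.
have CS' : (- d) ^+ 2 <= q * L ^+ 2 by rewrite sqrrN.
have r1l := focal_distance_ge L0 (ltW A0) r10 CS AE r1E.
have r2l := focal_distance_ge L0 (ltW A'0) r20 CS' A'E r2E'.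
have exc : r1 + r2 <= L + K / tau.
  apply: (excess L1' eA eA' AA qL).
    exact: focal_distance_le A0 L0 r10 q0 AE r1E.
  exact: focal_distance_le A'0 L0 r20 q0 A'E r2E'.
have kr1 := le_trans eA r1l; have kr2 := le_trans eA' r2l.
split=> //.
have c1 := focal_comparable L1' kr1 (le_trans (ler_wpDr r20 (lexx r1)) exc).
have c2 := focal_comparable L1' kr2 (le_trans (ler_wpDl r10 (lexx r2)) exc).
have w := weights_ge L0 (lt_le_trans tL0 kr1) (lt_le_trans tL0 kr2) m1 c1 c2.
have := phase_ge L0 eb r1l r2l exc es; rewrite -/D -ler_expR expRD => ph.
set G := expR (- b * L + _) in ph *.
have -> : (m `^ `|a'| * m `^ `|a|)^-1 * expR (- D) * (L `^ (a + a') * G) =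
  (m `^ `|a'| * m `^ `|a|)^-1 * L `^ (a + a') * (G * expR (- D)) by ring.
apply: ler_pM w ph; last by rewrite mulr_ge0 ?expR_ge0.
by rewrite mulr_ge0 ?powR_ge0// invr_ge0 mulr_ge0 ?powR_ge0.
Qed.

End pointwise_lower.

(** * Euclidean norm and radial functions *)

Section euclidean_norm.
Context {R : realType}.

Definition dotr n (y z : 'rV[R]_n) : R := \sum_(i < n) y ord0 i * z ord0 i.

Lemma enorm_ge0 n (x : 'rV[R]_n) : 0 <= enorm x.
Proof. exact: sqrtr_ge0. Qed.

Lemma sqr_enorm n (x : 'rV[R]_n) : enorm x ^+ 2 = \sum_(i < n) x ord0 i ^+ 2.
Proof. by rewrite sqr_sqrtr// sumr_ge0// => i _; exact: sqr_ge0. Qed.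

Lemma sqr_enormDZ n (y z : 'rV[R]_n) (k : R) :
  enorm (y + k *: z) ^+ 2 = enorm y ^+ 2 + 2 * k * dotr y z + k ^+ 2 * enorm z ^+ 2.
Proof.
rewrite !sqr_enorm /dotr !mulr_sumr -!big_split/=.
by apply: eq_bigr => i _; rewrite !mxE; ring.
Qed.

Lemma dotr_CauchySchwarz n (y z : 'rV[R]_n) :
  dotr y z ^+ 2 <= enorm y ^+ 2 * enorm z ^+ 2.
Proof.
have [z0|z0] := eqVneq (enorm z ^+ 2) 0.
  have zi i : z ord0 i = 0.
    have := z0; rewrite sqr_enorm => /eqP.
    rewrite psumr_eq0 => [/allP/(_ i)|j _]; last exact: sqr_ge0.
    by rewrite mem_index_enum sqrf_eq0 => /(_ isT)/eqP.
  by rewrite z0 mulr0 /dotr big1 ?expr0n// => i _; rewrite zi mulr0.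
have zp : 0 < enorm z ^+ 2 by rewrite lt0r z0 sqr_ge0.
have := sqr_ge0 (enorm (y + (- (dotr y z / enorm z ^+ 2)) *: z)).
rewrite sqr_enormDZ; set Z := enorm z ^+ 2 in z0 zp *; set Y := enorm y ^+ 2.
have -> : Y + 2 * - (dotr y z / Z) * dotr y z + (- (dotr y z / Z)) ^+ 2 * Z =
  (Y * Z - dotr y z ^+ 2) / Z by field.
by rewrite pmulr_lge0 ?invr_gt0// subr_ge0.
Qed.

Lemma enorm_col_perm n (s : 'S_n) (x : 'rV[R]_n) : enorm (col_perm s x) = enorm x.
Proof.
congr Num.sqrt; rewrite [RHS](reindex_inj (@perm_inj _ s)).
by apply: eq_bigr => i _; rewrite mxE.
Qed.

Lemma sqr_enorm_succ n (x : 'rV[R]_n.+1) :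
  enorm x ^+ 2 = x ord0 ord0 ^+ 2 + enorm (row_behead x) ^+ 2.
Proof.
by rewrite !sqr_enorm big_ord_recl; congr (_ + _); apply: eq_bigr => i _; rewrite mxE.
Qed.

Lemma measurable_enorm n : measurable_fun setT (@enorm R n).
Proof.
apply: measurableT_comp; first exact: continuous_measurable_fun (@sqrt_continuous R).
apply: measurable_sum => i.
by apply: measurable_funX; exact: measurable_coor.
Qed.

(** This is x = t xi + w with t = x0 / xi_0 and w = (0, y). Only the tail of xi meets w, and its
    squared norm is at most (1 - 1/(n+1)) |xi|^2: this is the angle condition with K = n+1. *)
Lemma bipolar_position n (xi : 'rV[R]_n.+1) (x0 : R) (y : 'rV[R]_n) :
  xi ord0 ord0 != 0 -> enorm xi ^+ 2 <= n.+1%:R * xi ord0 ord0 ^+ 2 ->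
  let x := row_cons (x0, y + x0 *: ((xi ord0 ord0)^-1 *: row_behead xi)) in
  bipolar n.+1%:R (enorm xi) (enorm x) (enorm (x - xi))
    (x0 / xi ord0 ord0) (dotr y (row_behead xi)) (enorm y ^+ 2).
Proof.
set m := xi ord0 ord0; set z := row_behead xi => m0 hm x.
have xiE : enorm xi ^+ 2 = m ^+ 2 + enorm z ^+ 2 by exact: sqr_enorm_succ.
have x00 : x ord0 ord0 = x0 by rewrite /x row_cons0.
have xm : (x - xi) ord0 ord0 = x0 - m by rewrite mxE x00 [(- xi) _ _]mxE.
have bx : row_behead x = y + (x0 / m) *: z.
  by rewrite /x; have := row_consK (x0, y + x0 *: (m^-1 *: z)) => -[_ ->]; rewrite scalerA.
have bxi : row_behead (x - xi) = y + (x0 / m - 1) *: z.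
  have -> : row_behead (x - xi) = row_behead x - z.
    by apply/rowP => j; rewrite !mxE.
  by rewrite bx scalerBl scale1r addrA.
split; rewrite ?enorm_ge0 ?sqr_ge0//.
- rewrite sqr_enorm_succ bx sqr_enormDZ xiE x00.
  by field.
- rewrite sqr_enorm_succ bxi sqr_enormDZ xiE xm.
  by field.
- have d2 := dotr_CauchySchwarz y z.
  have K0 : 0 <= n.+1%:R :> R by [].
  apply: (le_trans (ler_wpM2l K0 d2)).
  have -> : (n.+1%:R - 1) * enorm y ^+ 2 * enorm xi ^+ 2 =
    enorm y ^+ 2 * ((n.+1%:R - 1) * enorm xi ^+ 2) by ring.
  rewrite mulrCA ler_wpM2l ?sqr_ge0//.
  by move: hm; rewrite xiE; lra.
Qed.

End euclidean_norm.

(** * Radial functions through their profile on a ray *)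

Section radial_profile.
Context {R : realType} (n : nat) (u : 'rV[R]_n.+1 -> R).
Hypotheses (cu : continuous u) (ru : radial u).

(** Factoring u through the norm reduces measurability for the product sigma-algebra, and
    boundedness on balls, to a continuous function of one real variable. *)
Definition profile (r : R) : R := u (r *: delta_mx ord0 ord0).

Lemma continuous_profile : continuous profile.
Proof.
move=> r; apply: (@continuous_comp _ _ _ (fun r : R => r *: delta_mx ord0 ord0) u).
  exact: scalel_continuous.
exact: cu.
Qed.

Lemma radial_profile x : u x = profile (enorm x).
Proof.
apply: ru; apply/eqP; rewrite -(@eqrXn2 _ 2)// ?enorm_ge0//.
rewrite [eqbRHS]sqr_enorm (bigD1 ord0)//= big1 => [|i i0].
  by rewrite !mxE !eqxx mulr1 addr0.
by rewrite !mxE (negbTE i0) andbF mulr0 expr0n.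
Qed.

Lemma measurable_radial : measurable_fun setT u.
Proof.
rewrite (_ : u = profile \o @enorm R n.+1); last first.
  by apply/funext => x; exact: radial_profile.
apply: measurableT_comp; last exact: measurable_enorm.
exact: continuous_measurable_fun continuous_profile.
Qed.

Lemma radial_sim_le (a b c gamma : R) :
  (forall x, 0 < u x) -> 0 < b -> 0 < c ->
  sim_infty u
    (fun x => enorm x `^ a * expR (- b * enorm x + c * enorm x `^ gamma)) ->
  exists2 C, 0 < C & forall x,
    u x <= C * ((1 + enorm x) `^ a * expR (- b * enorm x + c * enorm x `^ gamma)).
Proof.
move=> u0 b0 c0 [C1 [C2 [r [C10 C20 hC]]]].
pose rho := Num.max r 1.
have rho1 : 1 <= rho by rewrite le_max lexx orbT.
have rho0 : 0 <= rho by exact: le_trans rho1.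
have [z _ hz] : exists2 z, z \in `[0, rho]%R &
    forall t, t \in `[0, rho]%R -> profile t <= profile z.
  by apply: EVT_max => //; apply: continuous_subspaceT; exact: continuous_profile.
(* On [0, rho] the comparison function is at least (1 + rho)^(-|a|) e^(-b rho); [B] compensates for
   this minimum. *)
pose B := profile z * (1 + rho) `^ `|a| * expR (b * rho).
have B0 : 0 < B by rewrite !mulr_gt0 ?expR_gt0 ?powR_gt0 ?u0// ltr_pwDl.
have C30 : 0 < C2 * 2 `^ `|a| by rewrite mulr_gt0// powR_gt0.
exists (B + C2 * 2 `^ `|a|); first by rewrite addr_gt0.
move=> x; set e := enorm x; set E := expR _.
have e0 : 0 <= e by exact: enorm_ge0.
have E0 : 0 < E by exact: expR_gt0.
have W0 : 0 <= (1 + e) `^ a * E by rewrite mulr_ge0 ?powR_ge0 ?(ltW E0).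
have [er|re] := leP e rho.
  apply: (@le_trans _ _ (B * ((1 + e) `^ a * E))); last first.
    by rewrite ler_wpM2r// lerDl ltW.
  rewrite radial_profile -/e; apply: (le_trans (hz _ _)).
    by rewrite in_itv/= e0.
  have z0 : 0 < profile z by exact: u0.
  have -> : B * ((1 + e) `^ a * E) =
    profile z * (((1 + rho) `^ `|a| * (1 + e) `^ a) * (expR (b * rho) * E)).
    by rewrite /B; ring.
  rewrite ler_pMr//; apply: mulr_ege1.
    apply: (@le_trans _ _ (1 `^ a)); first by rewrite powR1.
    apply: powR_comparable => //; first lra; first lra.
    rewrite ler_pdivrMr ?mul1r; last by lra.
    apply/andP; split; first lra.
    by rewrite mulr_ege1//; lra.
  rewrite -expRD -[leLHS]expR0 ler_expR.
  have i1 : 0 <= c * e `^ gamma by rewrite mulr_ge0 ?powR_ge0 ?(ltW c0).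
  have i2 : b * e <= b * rho by rewrite ler_pM2l.
  lra.
have re1 : r <= e by rewrite (le_trans _ (ltW re))// le_max lexx.
have [_ hu] := andP (hC x re1).
apply: (le_trans hu); rewrite -/e -/E.
apply: (@le_trans _ _ (C2 * 2 `^ `|a| * ((1 + e) `^ a * E))); last first.
  by rewrite ler_wpM2r// lerDr ltW.
rewrite -mulrA ler_pM2l// mulrA ler_pM2r//.
(* Beyond rho >= 1, e and 1 + e differ by a factor at most 2. *)
apply: powR_comparable; lra.
Qed.

End radial_profile.

(** * The convolution *)

Lemma profile_mul (R : realType) (C1 C2 w1 w2 b c1 c2 g r1 r2 : R) :
  C2 * (w2 * expR (- b * r2 + c2 * r2 `^ g)) *
    (C1 * (w1 * expR (- b * r1 + c1 * r1 `^ g))) =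
  C2 * C1 * (w1 * w2 * expR (- b * (r1 + r2) + c1 * r1 `^ g + c2 * r2 `^ g)).
Proof.
have -> : - b * (r1 + r2) + c1 * r1 `^ g + c2 * r2 `^ g =
  (- b * r2 + c2 * r2 `^ g) + (- b * r1 + c1 * r1 `^ g) by ring.
rewrite [in RHS]expRD; move: (expR _) (expR _) => E1 E2; ring.
Qed.

Section convolution.
Context {R : realType} (n : nat) (u v : 'rV[R]_n.+1 -> R).
Variables (g al be b a a' : R).
Hypotheses (cu : continuous u) (cv : continuous v) (u0 : forall x, 0 < u x)
  (v0 : forall x, 0 < v x) (ru : radial u) (rv : radial v).
Hypotheses (g01 : 0 < g < 1) (al0 : 0 < al) (be0 : 0 < be) (b0 : 0 < b).

Let c' := al `^ (1 - g).
Let c := be `^ (1 - g).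
Let ct := (al + be) `^ (1 - g).
Let K : R := n.+1%:R.
Let K1 : 1 <= K. Proof. by rewrite ler1n. Qed.
Let K0 : 0 < K. Proof. exact: lt_le_trans K1. Qed.
Let th0 := al / (al + be).

Hypothesis su : sim_infty u
  (fun x => enorm x `^ a * expR (- b * enorm x + c * enorm x `^ g)).
Hypothesis sv : sim_infty v
  (fun x => enorm x `^ a' * expR (- b * enorm x + c' * enorm x `^ g)).

Let f (xi : 'rV[R]_n.+1) x := translate xi u x * v x.

Let mf xi : measurable_fun setT (f xi).
Proof.
apply: measurable_funM; last exact: measurable_radial cv rv.
exact: (measurableT_comp (measurable_radial cu ru) (measurable_rV_addr (- xi))).
Qed.

Let f0 xi x : 0 < f xi x.
Proof. by apply: mulr_gt0; [exact: u0|exact: v0]. Qed.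

(* Coordinate 0 dominates, so the line R xi is transversal to {x_0 = 0}. *)
Let good (xi : 'rV[R]_n.+1) := enorm xi ^+ 2 <= K * xi ord0 ord0 ^+ 2.

(** [axial] is the length of the concentration region along xi; [gauge] is the size of the integrand
    there. *)
Let axial (L : R) := L * L `^ (- (g / 2)).
Let gauge (L : R) := L `^ (a + a') * expR (- b * L + ct * L `^ g).

Let good_neq0 xi : 0 < enorm xi -> good xi -> xi ord0 ord0 != 0.
Proof.
move=> L0; apply: contraTneq; rewrite /good => ->.
by rewrite expr0n mulr0 -ltNge exprn_gt0.
Qed.

Let good_le (xi : 'rV[R]_n.+1) : `|xi ord0 ord0| <= enorm xi.
Proof.
rewrite -ler_sqr ?nnegrE ?enorm_ge0// real_normK ?num_real//.
by rewrite sqr_enorm_succ lerDl sqr_ge0.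
Qed.

Let good_ge (xi : 'rV[R]_n.+1) : good xi -> enorm xi / K <= `|xi ord0 ord0|.
Proof.
move=> gx; rewrite ler_pdivrMr// -ler_sqr ?nnegrE ?enorm_ge0 ?mulr_ge0 ?(ltW K0)//.
apply: (le_trans gx); rewrite exprMn real_normK ?num_real// mulrC.
by rewrite ler_wpM2l ?sqr_ge0// expr2 ler_peMr// ltW.
Qed.

(** Here t is the coordinate x_0 and m is xi_0, so t / m is the parameter along xi and the kernel in
    x_0 has width |m| L^(-g/2). *)
Let sqr_axial (L t m : R) : 0 < L -> m != 0 ->
  ((t - th0 * m) / (`|m| * L `^ (- (g / 2)))) ^+ 2 = L `^ g * (t / m - th0) ^+ 2.
Proof.
move=> L0 m0; rewrite expr_div_n exprMn real_normK ?num_real//.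
have -> : (L `^ (- (g / 2))) ^+ 2 = (L `^ g)^-1.
  rewrite -powR_mulrn ?powR_ge0// -powRrM -powRN; congr powR.
  by rewrite mulNr divfK.
have Lg : L `^ g != 0 by rewrite gt_eqF// powR_gt0.
by field; rewrite m0.
Qed.

Lemma convolution_upper : exists C L1, [/\ 0 < C, 1 <= L1 &
  forall xi, good xi -> L1 <= enorm xi ->
  (\int[lebesgue_rV n.+1]_x (f xi x)%:E <=
    (C * gauge (enorm xi) * axial (enorm xi) * Num.sqrt (enorm xi) ^+ n)%:E)%E].
Proof.
have c0 : 0 < c by exact: powR_gt0.
have c'0 : 0 < c' by exact: powR_gt0.
have [Cu Cu0 hu] := radial_sim_le cu ru u0 b0 c0 su.
have [Cv Cv0 hv] := radial_sim_le cv rv v0 b0 c'0 sv.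
have [C [L1 [C0 L11 H]]] := pointwise_upper a a' n.+1 g01 al0 be0 b0 K1.
have pi0 := pi_gt0 R.
exists (Cu * Cv * C * pi * pi ^+ n), L1; split=> //.
  by rewrite !mulr_gt0// exprn_gt0.
move=> xi gx; set L := enorm xi => L1L.
have L1' : 1 <= L by exact: le_trans L1L.
have L0 : 0 < L by exact: lt_le_trans L1'.
have m0 := good_neq0 L0 gx; set m := xi ord0 ord0 in m0 *.
pose sg := `|m| * L `^ (- (g / 2)).
have sg0 : 0 < sg by rewrite mulr_gt0 ?normr_gt0 ?powR_gt0.
have sL0 : 0 < Num.sqrt L by rewrite sqrtr_gt0.
have G0 : 0 <= gauge L by rewrite mulr_ge0 ?powR_ge0 ?expR_ge0.
pose k0 x := (oneDsqr ((x - th0 * m) / sg))^-1 : R.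
pose k x := (oneDsqr ((x - 0) / Num.sqrt L))^-1 : R.
have mk (r s : R) : measurable_fun setT (fun x : R => (oneDsqr ((x - r) / s))^-1).
  apply: (measurableT_comp (continuous_measurable_fun (@continuous_oneDsqrV R))).
  by apply: measurable_funM => //; exact: measurable_funD.
have k0_ge0 (r s x : R) : 0 <= (oneDsqr ((x - r) / s))^-1.
  by rewrite invr_ge0 ltW// oneDsqr_gt0.
have CG0 : 0 <= Cu * Cv * C * gauge L by rewrite mulr_ge0// ltW// !mulr_gt0.
apply: (le_trans (@le_integral_shear R n (m^-1 *: row_behead xi) (f xi) k0 k
  (Cu * Cv * C * gauge L) (pi * sg) (pi * Num.sqrt L) (mf xi)
  (fun x => ltW (f0 xi x)) (mk _ _)
  (k0_ge0 _ _) (integral_oneDsqrV_affine (th0 * m) sg0) (mk _ _)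
  (k0_ge0 _ _) (integral_oneDsqrV_affine 0 sL0) CG0 _)).
  move=> t y; move: (bipolar_position t y m0 gx); rewrite -/m /=.
  move: (row_cons _) => x B; have Hx := H _ _ _ _ _ _ L1L B.
  have fle : f xi x <= Cu * Cv * ((1 + enorm x) `^ a' * (1 + enorm (x - xi)) `^ a *
      expR (- b * (enorm x + enorm (x - xi)) + c' * enorm x `^ g +
        c * enorm (x - xi) `^ g)).
    rewrite -profile_mul.
    exact: (ler_pM (ltW (u0 _)) (ltW (v0 _)) (hu (x - xi)) (hv x)).
  apply: (le_trans fle).
  have CuCv : 0 < Cu * Cv by exact: mulr_gt0.
  apply: (le_trans (ler_wpM2l (ltW CuCv) Hx)); rewrite -/(gauge L).
  have -> : Cu * Cv * C * gauge L * k0 t * \prod_(i < n) k (y ord0 i) =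
    Cu * Cv * (C * gauge L * (k0 t * \prod_(i < n) k (y ord0 i))) by ring.
  apply: (ler_wpM2l (ltW CuCv)); apply: ler_wpM2l.
    by apply: mulr_ge0; [exact: ltW|exact: G0].
  set Q := scaled_sqr _ _ _ _ _ _.
  have q0 : 0 <= enorm y ^+ 2 / L by rewrite divr_ge0 ?sqr_ge0// ltW.
  have p0 : 0 <= L `^ g * (t / m - th0) ^+ 2.
    by apply: mulr_ge0; [exact: powR_ge0|exact: sqr_ge0].
  have Q0 : 0 <= Q by rewrite addr_ge0.
  have k0E : k0 t = (1 + L `^ g * (t / m - th0) ^+ 2)^-1.
    by rewrite /k0 /oneDsqr sqr_axial.
  have kE z : k z = (1 + z ^+ 2 / L)^-1.
    by rewrite /k /oneDsqr subr0 expr_div_n sqr_sqrtr// ltW.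
  rewrite k0E; under eq_bigr do rewrite kE.
  (* Each of the n+1 kernel denominators is 1 plus a part of Q, hence at most 1 + Q, and their
     product is at most (1 + Q)^(n+1). *)
  rewrite prodfV -invfM lef_pV2 ?posrE; last 2 first.
  - by rewrite exprn_gt0// ltr_wpDr.
  - rewrite mulr_gt0 ?ltr_wpDr// prodr_gt0// => i _.
    by rewrite ltr_wpDr// divr_ge0 ?sqr_ge0// ltW.
  rewrite [leRHS]exprS; apply: ler_pM; first by rewrite addr_ge0.
  - apply: prodr_ge0 => i _; rewrite addr_ge0// divr_ge0 ?sqr_ge0//; exact: ltW.
  - by rewrite lerD2l /Q /scaled_sqr lerDl.
  rewrite -[X in _ <= _ ^+ X](card_ord n) -prodr_const; apply: ler_prod => i _.
  rewrite addr_ge0 ?divr_ge0 ?sqr_ge0 ?(ltW L0)//= lerD2l.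
  apply: (@le_trans _ _ (enorm y ^+ 2 / L)); last by rewrite /Q /scaled_sqr lerDr.
  rewrite ler_pM2r ?invr_gt0// sqr_enorm (bigD1 i)//= lerDl.
  by apply: sumr_ge0 => j _; exact: sqr_ge0.
rewrite lee_fin.
have -> : Cu * Cv * C * gauge L * (pi * sg) * (pi * Num.sqrt L) ^+ n =
  Cu * Cv * C * pi * pi ^+ n * gauge L * Num.sqrt L ^+ n * sg.
  by rewrite exprMn; ring.
have -> : Cu * Cv * C * pi * pi ^+ n * gauge L * axial L * Num.sqrt L ^+ n =
  Cu * Cv * C * pi * pi ^+ n * gauge L * Num.sqrt L ^+ n * axial L by ring.
apply: ler_wpM2l.
  apply: mulr_ge0; last by rewrite exprn_ge0 ?sqrtr_ge0.
  by apply: mulr_ge0 => //; apply: ltW; rewrite !mulr_gt0// exprn_gt0.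
by rewrite /sg /axial ler_wpM2r ?powR_ge0 ?good_le.
Qed.

Lemma convolution_lower : exists C L1, [/\ 0 < C, 1 <= L1 &
  forall xi, good xi -> L1 <= enorm xi ->
  ((C * gauge (enorm xi) * axial (enorm xi) * Num.sqrt (enorm xi) ^+ n)%:E <=
    \int[lebesgue_rV n.+1]_x (f xi x)%:E)%E].
Proof.
have [cu1 [cu2 [Ru [cu10 _ hu]]]] := su.
have [cv1 [cv2 [Rv [cv10 _ hv]]]] := sv.
have [cc [L1 [k1 [cc0 L11 k10 H]]]] := pointwise_lower a a' g01 al0 be0 b0 K1.
(* Each indicator has mass twice its width, and |xi_0| >= |xi| / K costs the factor 1 / K. The
   threshold puts k1 L beyond the radii where the asymptotics of u and v begin. *)
exists (cu1 * cv1 * cc * (2 / K) * 2 ^+ n), (L1 + (`|Ru| + `|Rv|) / k1); split.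
- by rewrite !mulr_gt0 ?invr_gt0 ?exprn_gt0.
- by rewrite (le_trans L11)// lerDl divr_ge0 ?addr_ge0// ltW.
move=> xi gx; set L := enorm xi => hL.
have RR0 : 0 <= (`|Ru| + `|Rv|) / k1 by rewrite divr_ge0 ?addr_ge0// ltW.
have L1L : L1 <= L by apply: le_trans hL; rewrite lerDl.
have L1' : 1 <= L by exact: le_trans L1L.
have L0 : 0 < L by exact: lt_le_trans L1'.
have kL : `|Ru| + `|Rv| <= k1 * L.
  rewrite -ler_pdivrMl// mulrC; apply: le_trans hL; rewrite lerDr.
  by rewrite (le_trans ler01).
have RuL : Ru <= k1 * L by rewrite (le_trans (ler_norm _))// (le_trans _ kL)// lerDl.
have RvL : Rv <= k1 * L by rewrite (le_trans (ler_norm _))// (le_trans _ kL)// lerDr.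
have m0 := good_neq0 L0 gx; set m := xi ord0 ord0 in m0 *.
pose sg := `|m| * L `^ (- (g / 2)).
have sg0 : 0 < sg by rewrite mulr_gt0 ?normr_gt0 ?powR_gt0.
have sL0 : 0 < Num.sqrt L by rewrite sqrtr_gt0.
have G0 : 0 <= gauge L by rewrite mulr_ge0 ?powR_ge0 ?expR_ge0.
pose I (r s : R) : set (measurableTypeR R) := `[r - s, r + s]%classic.
have mI r s : measurable (I r s) by exact: measurable_itv.
have iI r s : 0 < s ->
    (\int[lebesgue_measure]_x (\1_(I r s) x)%:E = (2 * s)%:E)%E.
  move=> s0; rewrite integral_indic//.
  change (lebesgue_measure (I r s `&` setT) = (2 * s)%:E).
  rewrite setIT /I lebesgue_measure_itv/= lte_fin.
  rewrite ifT -?EFinB; last by rewrite ltrD2l gtrN.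
  by congr EFin; ring.
have mk r s : measurable_fun setT (\1_(I r s) : R -> R).
  by apply: measurable_indic; exact: mI.
have k_ge0 r s x : 0 <= \1_(I r s) x :> R by rewrite indicE.
have CG0 : 0 <= cu1 * cv1 * cc * gauge L by rewrite mulr_ge0// ltW// !mulr_gt0.
apply: (le_trans _ (@ge_integral_shear R n (m^-1 *: row_behead xi) (f xi)
  (\1_(I (th0 * m) sg)) (\1_(I 0 (Num.sqrt L)))
  (cu1 * cv1 * cc * gauge L) (2 * sg) (2 * Num.sqrt L) (mf xi)
  (fun x => ltW (f0 xi x)) (mk _ _)
  (k_ge0 _ _) (iI _ _ sg0) (mk _ _) (k_ge0 _ _) (iI _ _ sL0) CG0 _)); last first.
  move=> t y; move: (bipolar_position t y m0 gx); rewrite -/m /=.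
  move: (row_cons _) => x B; move: (H _ _ _ _ _ _ L1L B); rewrite -/th0 => Hx.
  have [tI|tI] := boolP (t \in I (th0 * m) sg); last first.
    by rewrite indicE (negbTE tI) mulr0 mul0r ltW.
  have [/forallP yI|] := boolP [forall i, y ord0 i \in I 0 (Num.sqrt L)]; last first.
    rewrite negb_forall => /existsP[i yi].
    have yi0 : \1_(I 0 (Num.sqrt L)) (y ord0 i) = 0 :> R by rewrite indicE (negbTE yi).
    by rewrite (bigD1 i)//= yi0 mul0r mulr0 ltW.
  rewrite indicE tI big1 => [|i _]; last by rewrite indicE yI.
  rewrite !mulr1.
  have ht : (t / m - th0) ^+ 2 * L `^ g <= 1.
    rewrite mulrC -sqr_axial// -/sg expr_div_n ler_pdivrMr ?exprn_gt0// mul1r.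
    rewrite -[leLHS]real_normK ?num_real// ler_sqr ?nnegrE ?(ltW sg0)//.
    move: tI; rewrite inE /I/= in_itv/= ler_norml => /andP[t1 t2].
    by rewrite lerBrDl t1 lerBlDl t2.
  have hq : enorm y ^+ 2 <= K * L.
    rewrite sqr_enorm; apply: (@le_trans _ _ (\sum_(i < n) L)).
      apply: ler_sum => i _.
      have := yI i; rewrite inE /I/= in_itv/= sub0r add0r -ler_norml => hi.
      rewrite -[leLHS]real_normK ?num_real// -[leRHS](sqr_sqrtr (ltW L0)).
      by rewrite ler_sqr ?nnegrE ?sqrtr_ge0.
    rewrite sumr_const card_ord -mulr_natl ler_pM2r// ler_nat//.
  have [k1r1 k1r2 Hlow] := Hx ht hq.
  have /andP[hu1 _] := hu (x - xi) (le_trans RuL k1r2).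
  have /andP[hv1 _] := hv x (le_trans RvL k1r1).
  have CuCv : 0 < cu1 * cv1 by exact: mulr_gt0.
  apply: (@le_trans _ _ (cu1 * cv1 * (enorm x `^ a' * enorm (x - xi) `^ a *
      expR (- b * (enorm x + enorm (x - xi)) + c' * enorm x `^ g +
        c * enorm (x - xi) `^ g)))).
    have -> : cu1 * cv1 * cc * gauge L = cu1 * cv1 * (cc * gauge L).
      by rewrite !mulrA.
    exact: (ler_wpM2l (ltW CuCv)).
  rewrite -profile_mul.
  apply: ler_pM; last exact: hv1; last exact: hu1.
  - by apply: mulr_ge0; [exact: ltW|rewrite mulr_ge0 ?powR_ge0 ?expR_ge0].
  - by apply: mulr_ge0; [exact: ltW|rewrite mulr_ge0 ?powR_ge0 ?expR_ge0].
rewrite lee_fin.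
have -> : cu1 * cv1 * cc * gauge L * (2 * sg) * (2 * Num.sqrt L) ^+ n =
  cu1 * cv1 * cc * 2 * 2 ^+ n * gauge L * Num.sqrt L ^+ n * sg.
  by rewrite exprMn; ring.
have -> : cu1 * cv1 * cc * (2 / K) * 2 ^+ n * gauge L * axial L * Num.sqrt L ^+ n =
  cu1 * cv1 * cc * 2 * 2 ^+ n * gauge L * Num.sqrt L ^+ n * (axial L / K) by ring.
apply: ler_wpM2l.
  apply: mulr_ge0; last by rewrite exprn_ge0 ?sqrtr_ge0.
  by apply: mulr_ge0 => //; apply: ltW; rewrite !mulr_gt0// exprn_gt0.
rewrite /sg /axial mulrAC ler_wpM2r ?powR_ge0//.
exact: good_ge.
Qed.

End convolution.

(** * Reduction to a dominant first coordinate and conclusion *)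

Lemma enorm_le_max_coord (R : realType) n (xi : 'rV[R]_n.+1) :
  exists i, enorm xi ^+ 2 <= n.+1%:R * xi ord0 i ^+ 2.
Proof.
exists [arg max_(i > ord0) (xi ord0 i ^+ 2)]%O.
case: arg_maxP => // i _ hi; rewrite sqr_enorm.
apply: (@le_trans _ _ (\sum_(j < n.+1) xi ord0 i ^+ 2)).
  by apply: ler_sum => j _; exact: hi.
by rewrite sumr_const card_ord mulr_natl.
Qed.

(** Permuting the coordinates preserves Lebesgue measure and the norm, so the largest coordinate of
    xi may be moved to position 0. *)
Lemma radial_convolution_col_perm (R : realType) n (u v : 'rV[R]_n.+1 -> R)
    (s : 'S_n.+1) (xi : 'rV[R]_n.+1) :
  continuous u -> continuous v -> (forall x, 0 < u x) -> (forall x, 0 < v x) ->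
  radial u -> radial v ->
  (\int[lebesgue_rV n.+1]_x (translate xi u x * v x)%:E =
   \int[lebesgue_rV n.+1]_x (translate (col_perm s xi) u x * v x)%:E)%E.
Proof.
move=> cu cv u0 v0 ru rv.
rewrite -(integral_rV_col_perm s
  (f := fun x => (translate (col_perm s xi) u x * v x)%:E)).
- apply: eq_integral => x _; rewrite /translate; congr (_ * _)%:E.
    apply: ru; rewrite (_ : col_perm s x - col_perm s xi = col_perm s (x - xi)).
      by rewrite enorm_col_perm.
    by apply/rowP => j; rewrite !mxE.
  by apply: rv; rewrite enorm_col_perm.
- apply/measurable_EFinP; apply: measurable_funM; last exact: measurable_radial cv rv.
  exact: (measurableT_comp (measurable_radial cu ru) (measurable_rV_addr _)).
- by move=> x; rewrite lee_fin mulr_ge0// ltW//; exact: u0.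
Qed.

Theorem lemma4p2 (R : realType) (N : nat) (u v : 'rV[R]_N -> R)
    (a a' b c c' gamma : R) :
  (2 <= N)%N ->
  continuous u -> continuous v ->
  (forall x, 0 < u x) -> (forall x, 0 < v x) ->
  radial u -> radial v ->
  0 < b -> 0 < gamma < 1 -> 0 < c -> 0 < c' ->
  sim_infty u
    (fun x => enorm x `^ a * expR (- b * enorm x + c * enorm x `^ gamma)) ->
  sim_infty v
    (fun x => enorm x `^ a' * expR (- b * enorm x + c' * enorm x `^ gamma)) ->
  let ctilde :=
    (c' `^ (1 / (1 - gamma)) + c `^ (1 / (1 - gamma))) `^ (1 - gamma) in
  sim_infty
    (fun xi => \int[lebesgue_rV N]_x (translate xi u x * v x))
    (fun xi => enorm xi `^ ((N%:R + 1) / 2 + a + a' - gamma / 2) *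
               expR (- b * enorm xi + ctilde * enorm xi `^ gamma)).
Proof.
case: N u v => [//|n] u v _ cu cv u0 v0 ru rv b0 g01 c0 c'0 su sv ctilde.
have /andP[g0 g1] := g01.
have g1' : 1 - gamma != 0 by rewrite subr_eq0 gt_eqF.
pose al := c' `^ (1 / (1 - gamma)); pose be := c `^ (1 / (1 - gamma)).
have al0 : 0 < al by exact: powR_gt0.
have be0 : 0 < be by exact: powR_gt0.
have alE : al `^ (1 - gamma) = c' by rewrite -powRrM mul1r mulVf// powRr1// ltW.
have beE : be `^ (1 - gamma) = c by rewrite -powRrM mul1r mulVf// powRr1// ltW.
rewrite -alE in sv; rewrite -beE in su.
have [C2 [L2 [C20 L21 H2]]] := convolution_upper cu cv u0 v0 ru rv g01 al0 be0 b0 su sv.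
have [C1 [L1 [C10 L11 H1]]] := convolution_lower cu cv u0 v0 ru rv g01 al0 be0 b0 su sv.
exists C1, C2, (L1 + L2); split=> // xi hL.
have [i hi] := enorm_le_max_coord xi.
pose xi' := col_perm (tperm ord0 i) xi.
have xi'E : enorm xi' = enorm xi by exact: enorm_col_perm.
have gxi : enorm xi' ^+ 2 <= n.+1%:R * xi' ord0 ord0 ^+ 2.
  by rewrite xi'E mxE tpermL.
have L1L : L1 <= enorm xi' by rewrite xi'E (le_trans _ hL)// lerDl (le_trans ler01).
have L2L : L2 <= enorm xi' by rewrite xi'E (le_trans _ hL)// lerDr (le_trans ler01).
have := H2 _ gxi L2L; have := H1 _ gxi L1L.
rewrite -radial_convolution_col_perm// xi'E /Rintegral.
set I := integral _ _ _; set L := enorm xi.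
have L0 : 0 < L by rewrite /L -xi'E (lt_le_trans _ L1L)// (lt_le_trans ltr01).
(* With N = n+1, the height a + a', the axial length 1 - gamma/2 and the n widths 1/2 add up to the
   stated exponent. *)
have powE : L `^ ((n.+1%:R + 1) / 2 + a + a' - gamma / 2) =
    L `^ (a + a') * (L * L `^ (- (gamma / 2))) * Num.sqrt L ^+ n.
  have Ln : L != 0 by rewrite gt_eqF.
  rewrite -powR12_sqrt ?(ltW L0)// -powR_mulrn ?powR_ge0// -powRrM.
  rewrite -[X in X * L `^ (- _)](powRr1 (ltW L0)).
  rewrite -!powRD ?Ln ?implybT//; congr powR.
  by rewrite -[n.+1%:R]natr1; field.
have gaugeE C :
    C * (L `^ (a + a') *
      expR (- b * L + (al + be) `^ (1 - gamma) * L `^ gamma)) *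
    (L * L `^ (- (gamma / 2))) * Num.sqrt L ^+ n =
  C * (L `^ ((n.+1%:R + 1) / 2 + a + a' - gamma / 2) *
    expR (- b * L + ctilde * L `^ gamma)).
  by rewrite powE -[ctilde]/((al + be) `^ (1 - gamma)); move: (expR _) => E; ring.
rewrite !gaugeE.
(* An infinite value of [I] contradicts one of the two bounds, so the real-valued integral is the
   true one. *)
by case: I => [r| |]; rewrite ?lee_fin//= => -> ->.
Qed.
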